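(* Let $k$ be an algebraically closed field, let $x\in\mathbb P^1=\mathbb P^1_k$ be a closed point, and let $\mathcal E=\bigoplus_{i=1}^n\mathcal O(d_i)$ and $\mathcal E'=\bigoplus_{i=1}^n\mathcal O(d_i')$ be rank $n$ vector bundles on $\mathbb P^1$, with $d_1\le\dots\le d_n$ and $d'_1\le\dots\le d'_n$. Let $r\in\{0,1,\dots,n\}$. Then $\mathcal E'$ is a Hecke modification of $\mathcal E$ at $x$ with weight $r$ if and only if there is $\delta\in\Delta_r^n$ such that $d_i'=d_i-\delta(i)$ for all $i\in\{1,\dots,n\}$.
   Context: $\mathcal E'$ is a Hecke modification of $\mathcal E$ at $x$ with weight $r$ if there is a short exact sequence of coherent sheaves $0\to\mathcal E'\to\mathcal E\to\mathcal K_x^{\oplus r}\to0$, where $\mathcal K_x^{\oplus r}$ is the skyscraper sheaf supported at $x$ with stalk $\kappa(x)^{\oplus r}$ ($\kappa(x)$ the residue field). $\Delta_r^n$ is the set of functions $f:\{1,\dots,n\}\to\{0,1\}$ taking the value $1$ at exactly $r$ indices. *)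

(* Defs.v *)
From HB Require Import structures.
From mathcomp Require Import all_boot all_order all_algebra.
From mathcomp Require Import boolp classical_sets functions.
From mathcomp Require Import mpoly zify.

Set Implicit Arguments.
Unset Strict Implicit.
Unset Printing Implicit Defensive.

Import Order.TTheory GRing.Theory Num.Theory.
Local Open Scope classical_set_scope.
Local Open Scope ring_scope.

(* As k is algebraically closed, P^1 is handled as a classical variety: its
   points are the closed points of the scheme P^1_k.  Restriction to closed
   points is a bijection from the open subsets of the scheme to those of the
   variety which preserves inclusions and coverings and identifies the two
   structure sheaves, so sheaves of modules and exact sequences of such are the
   same on both. *)

Record P1 (k : closedFieldType) := LineOf {
  line : {vspace 'rV[k]_2};
  dim_line : \dim line = 1%N }.

(* v is a vector of homogeneous coordinates of p *)
Definition coords (k : closedFieldType) (p : P1 k) (v : 'rV[k]_2) : Prop :=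
  v \in line p /\ v != 0.

Definition homogeneous (k : closedFieldType) (F : {mpoly k[2]}) : Prop :=
  exists m : nat, F \is m.-homog.

(* Complements of the zero loci of sets of homogeneous polynomials. *)
Definition zariski_open (k : closedFieldType) (U : set (P1 k)) : Prop :=
  exists T : set {mpoly k[2]}, (forall F, T F -> homogeneous F) /\
    forall p, U p <-> exists2 F, T F & forall v, coords p v -> F.@[v 0] != 0.

Record opens (k : closedFieldType) := Opens {
  opens_set :> set (P1 k);
  opensP : zariski_open opens_set }.

Section Zariski.
Variable k : closedFieldType.
Implicit Types (p : P1 k) (U V W : opens k).

Lemma zariski_open0 : zariski_open (set0 : set (P1 k)).
Proof. by exists set0; split=> // p; split => // -[]. Qed.

Lemma zariski_openT : zariski_open (setT : set (P1 k)).
Proof.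
exists [set 1]; split.
  by move=> _ ->; exists 0%N; exact: dhomog1.
move=> p; split => // _; exists 1 => // v _.
by rewrite meval1 oner_neq0.
Qed.

Lemma zariski_openI (A B : set (P1 k)) :
  zariski_open A -> zariski_open B -> zariski_open (A `&` B).
Proof.
move=> [S [hS AS]] [T [hT BT]].
exists [set FG | exists F G, [/\ S F, T G & FG = F * G]]; split.
  move=> _ [F [G [SF TG ->]]]; have [a Fa] := hS _ SF; have [b Gb] := hT _ TG.
  by exists (a + b)%N; exact: dhomogM.
move=> p; split=> [[/AS[F SF F0] /BT[G TG G0]]|[_ [F [G [SF TG ->]]] FG0]].
  exists (F * G); first by exists F, G.
  by move=> v pv; rewrite mevalM mulf_neq0 ?F0 ?G0.
split; [apply/AS; exists F => // v pv|apply/BT; exists G => // v pv];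
  by have := FG0 v pv; rewrite mevalM mulf_eq0 negb_or => /andP[].
Qed.

Lemma zariski_open_bigcup (I : Type) (A : I -> set (P1 k)) :
  (forall i, zariski_open (A i)) -> zariski_open (\bigcup_i A i).
Proof.
move=> /choice[T hT]; exists [set F | exists i, T i F]; split.
  by move=> F [i]; case: (hT i) => h _; exact: h.
move=> p; split=> [[i _ Ap]|[F [i TF] F0]].
  by case: (hT i) => _ /(_ p)[/(_ Ap)[F TF F0] _]; exists F => //; exists i.
by exists i => //; case: (hT i) => _ /(_ p)[_]; apply; exists F.
Qed.

End Zariski.

Section Sections.
Variable k : closedFieldType.

(* The part over U of the punctured plane: pairs of a point of U and a vector of
   homogeneous coordinates for it. *)
Record cone (U : opens k) := Cone {
  base : U;
  vec : 'rV[k]_2;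
  coords_vec : coords (\val base) vec }.

Definition is_regular (U : opens k) (f : U -> k) : Prop :=
  forall p : U, exists V : opens k, opens_set V (\val p) /\
  exists m (F G : {mpoly k[2]}), [/\ F \is m.-homog, G \is m.-homog &
    forall c : cone U, opens_set V (\val (base c)) ->
      G.@[vec c 0] != 0 /\ f (base c) = F.@[vec c 0] / G.@[vec c 0]].

(* Sections of O(d) over U, i.e. of the sheaf attached to the graded module
   k[X, Y](d): locally fractions F / G of homogeneous polynomials with
   deg F - deg G = d, seen as functions of the homogeneous coordinates. *)
Definition is_twisted (d : int) (U : opens k) (s : cone U -> k) : Prop :=
  forall p : U, exists V : opens k, opens_set V (\val p) /\
  exists m l (F G : {mpoly k[2]}),
    [/\ F \is m.-homog, G \is l.-homog, m%:Z - l%:Z = d &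
    forall c : cone U, opens_set V (\val (base c)) ->
      G.@[vec c 0] != 0 /\ s c = F.@[vec c 0] / G.@[vec c 0]].

Definition regular_pred (U : opens k) : {pred U -> k} :=
  fun f => `[< is_regular f >].

Definition twisted_pred (d : int) (U : opens k) : {pred cone U -> k} :=
  fun s => `[< is_twisted d s >].

Definition opensI (U V : opens k) : opens k :=
  Opens (zariski_openI (opensP U) (opensP V)).

Definition opensT : opens k := Opens (@zariski_openT k).

Fact regular_subring_closed (U : opens k) : subring_closed (@regular_pred U).
Proof.
split=> [|f g /asboolP hf /asboolP hg|f g /asboolP hf /asboolP hg]; apply/asboolP.
- move=> p; exists opensT; split=> //; exists 0%N, 1, 1.
  split; [exact: dhomog1|exact: dhomog1|move=> c _].
  by rewrite meval1 oner_neq0 divr1.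
- move=> p; have [V [Vp [m [F [G [Fm Gm FG]]]]]] := hf p.
  have [V' [Vp' [m' [F' [G' [Fm' Gm' FG']]]]]] := hg p.
  exists (opensI V V'); split=> //.
  exists (m + m')%N, (F * G' - F' * G), (G * G'); split.
  + by apply: rpredB; [|rewrite addnC]; exact: dhomogM.
  + exact: dhomogM.
  + move=> c [/FG[G0 fE] /FG'[G0' gE]]; rewrite mevalB !mevalM mulf_neq0 //.
    split=> //; rewrite -[LHS]/(f (base c) - g (base c)) fE gE.
    by rewrite -mulNr addf_div // mulNr.
- move=> p; have [V [Vp [m [F [G [Fm Gm FG]]]]]] := hf p.
  have [V' [Vp' [m' [F' [G' [Fm' Gm' FG']]]]]] := hg p.
  exists (opensI V V'); split=> //.
  exists (m + m')%N, (F * F'), (G * G'); split; [exact: dhomogM|exact: dhomogM|].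
  move=> c [/FG[G0 fE] /FG'[G0' gE]]; rewrite !mevalM mulf_neq0 //.
  by split=> //; rewrite -[LHS]/(f (base c) * g (base c)) fE gE mulf_div.
Qed.

Lemma coord_nbhs (p : P1 k) : exists V : opens k, opens_set V p /\
  exists i, forall q, opens_set V q -> forall v, coords q v -> v 0 i != 0.
Proof.
have [v pv] : exists v, coords p v.
  exists (vpick (line p)); split; first exact: memv_pick.
  by rewrite vpick0 -dimv_eq0 dim_line.
have /rV0Pn[i vi] := pv.2.
have oV : zariski_open [set q : P1 k | forall w, coords q w -> w 0 i != 0].
  exists [set 'X_i : {mpoly k[2]}]; split=> [_ ->|q].
    by exists 1%N; rewrite dhomogX; apply/eqP; exact: mdeg1.
  split=> [qi|[_ -> qi] w qw].
    by exists 'X_i => // w /qi; rewrite mevalXU.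
  by have := qi w qw; rewrite mevalXU.
exists (Opens oV); split; last by exists i.
move=> w [pw w0]; have lp : line p = <[v]>%VS.
  apply/eqP; rewrite eq_sym eqEdim -memvE pv.1 dim_line dim_vline.
  by case: (v =P 0) pv.2.
move: pw; rewrite lp => /vlineP[a wE]; rewrite wE mxE mulf_neq0 //.
by apply: contraNneq w0 => a0; rewrite wE a0 scale0r.
Qed.

Fact twisted_zmod_closed d (U : opens k) : zmod_closed (@twisted_pred d U).
Proof.
split=> [|s t /asboolP hs /asboolP ht]; apply/asboolP => p.
- have [V [Vp [i Vi]]] := coord_nbhs (\val p); exists V; split=> //.
  case: d => b; [exists b, 0%N, 0, 1|exists 0%N, b.+1, 0, ('X_i ^+ b.+1)]; split.
  + exact: rpred0.
  + exact: dhomog1.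
  + by rewrite subr0.
  + by move=> c _; rewrite meval1 oner_neq0 meval0 mul0r.
  + exact: rpred0.
  + have Xi : ('X_i : {mpoly k[2]}) \is 1.-homog.
      by rewrite dhomogX; apply/eqP; exact: mdeg1.
    by have := dhomogMn b.+1 Xi; rewrite mul1n.
  + by rewrite sub0r NegzE.
  + move=> c Vc; have ci := Vi _ Vc _ (coords_vec c).
    by rewrite rmorphXn/= mevalXU expf_neq0// meval0 mul0r.
- have [V [Vp [a [b [F [G [Fa Gb ab FG]]]]]]] := hs p.
  have [V' [Vp' [a' [b' [F' [G' [Fa' Gb' ab' FG']]]]]]] := ht p.
  exists (opensI V V'); split=> //.
  exists (a + b')%N, (b + b')%N, (F * G' - F' * G), (G * G'); split.
  + apply: rpredB; first exact: dhomogM.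
    have -> : (a + b' = a' + b)%N by lia.
    exact: dhomogM.
  + exact: dhomogM.
  + lia.
  + move=> c [/FG[G0 sE] /FG'[G0' tE]]; rewrite mevalB !mevalM mulf_neq0 //.
    split=> //; rewrite -[LHS]/(s c - t c) sE tE.
    by rewrite -mulNr addf_div // mulNr.
Qed.

HB.instance Definition _ d (U : opens k) :=
  GRing.isZmodClosed.Build (cone U -> k) (@twisted_pred d U)
    (twisted_zmod_closed d U).

(* O(U) *)
Record regular (U : opens k) := Regular {
  regular_val :> U -> k;
  regularP : regular_val \in @regular_pred U }.

HB.instance Definition _ (U : opens k) := [isSub for @regular_val U].
HB.instance Definition _ (U : opens k) := [Choice of regular U by <:].
HB.instance Definition _ (U : opens k) :=
  GRing.SubChoice_isSubComPzRing.Build (U -> k) (@regular_pred U) (regular U)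
    (regular_subring_closed U).

(* O(d)(U) *)
Record twisted (d : int) (U : opens k) := Twisted {
  twisted_val :> cone U -> k;
  twistedP : twisted_val \in @twisted_pred d U }.

HB.instance Definition _ d (U : opens k) := [isSub for @twisted_val d U].
HB.instance Definition _ d (U : opens k) := [Choice of twisted d U by <:].
HB.instance Definition _ d (U : opens k) :=
  [SubChoice_isSubZmodule of twisted d U by <:].

Fact twisted_scale_subproof d U (f : regular U) (s : twisted d U) :
  (fun c => f (base c) * s c) \in @twisted_pred d U.
Proof.
case: f s => f /= /asboolP hf [s /= /asboolP hs]; apply/asboolP => p.
have [V [Vp [m [F [G [Fm Gm FG]]]]]] := hf p.
have [V' [Vp' [a [b [F' [G' [Fa Gb ab FG']]]]]]] := hs p.
exists (opensI V V'); split=> //.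
exists (m + a)%N, (m + b)%N, (F * F'), (G * G').
split; [exact: dhomogM|exact: dhomogM|lia|].
move=> c [/FG[G0 fE] /FG'[G0' sE]]; rewrite !mevalM mulf_neq0 //.
by split=> //; rewrite fE sE mulf_div.
Qed.

Definition twisted_scale d U (f : regular U) (s : twisted d U) : twisted d U :=
  Twisted (twisted_scale_subproof f s).

Fact twisted_scaleA d U (f g : regular U) (s : twisted d U) :
  twisted_scale f (twisted_scale g s) = twisted_scale (f * g) s.
Proof. by apply/val_inj/funext => c; rewrite /= mulrA. Qed.

Fact twisted_scale1 d U : left_id 1 (@twisted_scale d U).
Proof. by move=> s; apply/val_inj/funext => c; rewrite /= mul1r. Qed.

Fact twisted_scaleDr d U : right_distributive (@twisted_scale d U) +%R.
Proof. by move=> f s t; apply/val_inj/funext => c; rewrite /= mulrDr. Qed.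

Fact twisted_scaleDl d U (s : twisted d U) :
  {morph (@twisted_scale d U)^~ s : f g / f + g}.
Proof. by move=> f g; apply/val_inj/funext => c; rewrite /= mulrDl. Qed.

HB.instance Definition _ d (U : opens k) :=
  GRing.Zmodule_isLmodule.Build (regular U) (twisted d U)
    (@twisted_scaleA d U) (@twisted_scale1 d U) (@twisted_scaleDr d U)
    (@twisted_scaleDl d U).

Definition incl (U V : opens k) (VU : V `<=` U) (p : V) : U :=
  exist _ (\val p) (mem_set (VU _ (set_mem (valP p)))).

Definition cone_incl (U V : opens k) (VU : V `<=` U) (c : cone V) : cone U :=
  @Cone U (incl VU (base c)) (vec c) (coords_vec c).

Fact regular_res_subproof (U V : opens k) (VU : V `<=` U) (f : regular U) :
  (fun p => f (incl VU p)) \in @regular_pred V.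
Proof.
case: f => f /= /asboolP hf; apply/asboolP => p.
have [W [Wp [m [F [G [Fm Gm FG]]]]]] := hf (incl VU p).
exists W; split=> //; exists m, F, G; split=> // c Wc.
exact: FG (cone_incl VU c) Wc.
Qed.

Definition regular_res (U V : opens k) (VU : V `<=` U) (f : regular U) : regular V :=
  Regular (regular_res_subproof VU f).

Fact twisted_res_subproof d (U V : opens k) (VU : V `<=` U) (s : twisted d U) :
  (fun c => s (cone_incl VU c)) \in @twisted_pred d V.
Proof.
case: s => s /= /asboolP hs; apply/asboolP => p.
have [W [Wp [a [b [F [G [Fa Gb ab FG]]]]]]] := hs (incl VU p).
exists W; split=> //; exists a, b, F, G; split=> // c Wc.
exact: FG (cone_incl VU c) Wc.
Qed.

Definition twisted_res d (U V : opens k) (VU : V `<=` U) (s : twisted d U) : twisted d V :=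
  Twisted (twisted_res_subproof VU s).

End Sections.

Definition covers (k : closedFieldType) (U : opens k) (I : Type)
    (V : I -> opens k) : Prop :=
  forall p : U, exists i, opens_set (V i) (\val p).

(* Sheaves of O-modules on P^1. *)
Record sheaf (k : closedFieldType) := Sheaf {
  sec : forall U : opens k, lmodType (regular U);
  res : forall U V : opens k, V `<=` U -> sec U -> sec V;
  resD : forall (U V : opens k) (VU : V `<=` U) (s t : sec U),
    res VU (s + t) = res VU s + res VU t;
  resZ : forall (U V : opens k) (VU : V `<=` U) (f : regular U) (s : sec U),
    res VU (f *: s) = regular_res VU f *: res VU s;
  res_id : forall (U : opens k) (UU : U `<=` U) (s : sec U), res UU s = s;
  res_res : forall (U V W : opens k) (VU : V `<=` U) (WV : W `<=` V) (WU : W `<=` U)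
    (s : sec U), res WV (res VU s) = res WU s;
  sheaf_ext : forall (U : opens k) (I : Type) (V : I -> opens k)
    (VU : forall i, V i `<=` U), covers U V ->
    forall s t : sec U, (forall i, res (VU i) s = res (VU i) t) -> s = t;
  sheaf_glue : forall (U : opens k) (I : Type) (V : I -> opens k)
    (VU : forall i, V i `<=` U), covers U V ->
    forall s : forall i, sec (V i),
    (forall i j (W : opens k) (Wi : W `<=` V i) (Wj : W `<=` V j),
       res Wi (s i) = res Wj (s j)) ->
    exists t : sec U, forall i, res (VU i) t = s i }.

Record sheaf_hom (k : closedFieldType) (F G : sheaf k) := SheafHom {
  hom_sec :> forall U : opens k, {linear sec F U -> sec G U};
  hom_res : forall (U V : opens k) (VU : V `<=` U) (s : sec F U),
    hom_sec V (res VU s) = res VU (hom_sec U s) }.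

(* 0 -> F -> G -> H -> 0 is exact: the first map is injective, the second is
   locally surjective, and its kernel is the (sheafified) image of the first. *)
Definition short_exact (k : closedFieldType) (F G H : sheaf k)
    (phi : sheaf_hom F G) (psi : sheaf_hom G H) : Prop :=
  [/\ forall U, injective (phi U),
      forall U (t : sec G U), psi U t = 0 <->
        forall p : U, exists (V : opens k) (VU : V `<=` U),
          opens_set V (\val p) /\ exists s, phi V s = res VU t
    & forall U (u : sec H U) (p : U), exists (V : opens k) (VU : V `<=` U),
        opens_set V (\val p) /\ exists t, psi V t = res VU u].

Section Twist.
Variables (k : closedFieldType) (d : int).
Implicit Types U V W : opens k.

Fact twisted_resD U V (VU : V `<=` U) (s t : twisted d U) :
  twisted_res VU (s + t) = twisted_res VU s + twisted_res VU t.
Proof. by apply/val_inj/funext. Qed.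

Fact twisted_resZ U V (VU : V `<=` U) (f : regular U) (s : twisted d U) :
  twisted_res VU (f *: s) = regular_res VU f *: twisted_res VU s.
Proof. by apply/val_inj/funext. Qed.

Fact cone_eq U (c c' : cone U) :
  \val (base c) = \val (base c') -> vec c = vec c' -> c = c'.
Proof.
case: c c' => [p v pv] [q w qw] /= /val_inj pq vw.
by case: _ / pq qw => qw; case: _ / vw qw => qw; congr Cone.
Qed.

Fact twisted_res_id U (UU : U `<=` U) (s : twisted d U) : twisted_res UU s = s.
Proof.
by apply/val_inj/funext => c /=; congr (twisted_val s _); exact: cone_eq.
Qed.

Fact twisted_res_res U V W (VU : V `<=` U) (WV : W `<=` V) (WU : W `<=` U)
  (s : twisted d U) : twisted_res WV (twisted_res VU s) = twisted_res WU s.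
Proof.
by apply/val_inj/funext => c /=; congr (twisted_val s _); exact: cone_eq.
Qed.

Lemma cone_sub U V (c : cone U) : opens_set V (\val (base c)) ->
  exists c' : cone V, \val (base c') = \val (base c) /\ vec c' = vec c.
Proof.
move=> Vc.
by exists (@Cone _ V (exist _ (\val (base c)) (mem_set Vc)) (vec c) (coords_vec c)).
Qed.

Fact twisted_sheaf_ext U (I : Type) (V : I -> opens k)
    (VU : forall i, V i `<=` U) (UV : covers U V) (s t : twisted d U) :
  (forall i, twisted_res (VU i) s = twisted_res (VU i) t) -> s = t.
Proof.
move=> st; apply/val_inj/funext => c.
have [i /cone_sub[c' [bc vc]]] := UV (base c).
have <- : cone_incl (VU i) c' = c by exact: cone_eq.
exact: (congr1 (fun u : twisted d (V i) => u c') (st i)).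
Qed.

Fact twisted_sheaf_glue U (I : Type) (V : I -> opens k)
    (VU : forall i, V i `<=` U) (UV : covers U V)
    (s : forall i, twisted d (V i)) :
  (forall i j (W : opens k) (Wi : W `<=` V i) (Wj : W `<=` V j),
     twisted_res Wi (s i) = twisted_res Wj (s j)) ->
  exists t : twisted d U, forall i, twisted_res (VU i) t = s i.
Proof.
move=> sij.
have sE i j (c : cone (V i)) (c' : cone (V j)) :
    \val (base c) = \val (base c') -> vec c = vec c' -> s i c = s j c'.
  move=> bb vv.
  have Wi : opensI (V i) (V j) `<=` V i by move=> ? [].
  have Wj : opensI (V i) (V j) `<=` V j by move=> ? [].
  have hc : opens_set (opensI (V i) (V j)) (\val (base c)).
    by split; [exact: set_mem (valP _)|rewrite bb; exact: set_mem (valP _)].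
  have [e [be ve]] := cone_sub hc.
  have -> : c = cone_incl Wi e by exact: cone_eq.
  have -> : c' = cone_incl Wj e by apply: cone_eq; rewrite /= ?be ?ve.
  exact: (congr1 (fun u : twisted d (opensI (V i) (V j)) => u e) (sij _ _ _ _ _)).
have tP (c : cone U) : exists a, forall i (c' : cone (V i)),
      \val (base c') = \val (base c) -> vec c' = vec c -> a = s i c'.
  have [i /cone_sub[c1 [b1 v1]]] := UV (base c).
  exists (s i c1) => j c' b' v'; apply: sE; first by rewrite b1.
  by rewrite v1.
have [t tE] := choice tP.
have tt : t \in @twisted_pred k d U.
  apply/asboolP => p; have [i Vp] := UV p.
  have [s0 /asboolP hs sval] : exists2 s0, s0 \in @twisted_pred k d (V i) &
      twisted_val (s i) = s0 by exists (s i) => //; exact: twistedP.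
  have [W [Wp [a [b [F [G [Fa Gb ab FG]]]]]]] :=
    hs (exist _ (\val p) (mem_set Vp)).
  exists (opensI (V i) W); split=> //; exists a, b, F, G; split=> //.
  move=> c [/cone_sub[c' [bc vc]] Wc].
  have := FG c'; rewrite bc => /(_ Wc)[G0 sFG].
  by rewrite -vc; split=> //; rewrite (tE c i c') // sval.
exists (Twisted tt) => i; apply/val_inj/funext => c /=.
exact: tE.
Qed.

(* O(d) *)
Definition twist : sheaf k := Sheaf twisted_resD twisted_resZ twisted_res_id
  twisted_res_res twisted_sheaf_ext twisted_sheaf_glue.

End Twist.

Section Skyscraper.
Variables (k : closedFieldType) (x : P1 k).
Implicit Types U V W : opens k.

(* Sections over U of the direct image of the residue field along the inclusion
   of x.  The domain of the functions is a proposition, so this is k if x is in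
   U, and 0 otherwise; the residue field of x is k, on which a regular function
   f acts through its value f(x). *)
Definition sky U : Type := opens_set U x -> k.

HB.instance Definition _ U := GRing.Zmodule.on (sky U).

Definition sky_scale U (f : regular U) (s : sky U) : sky U :=
  fun xU => f (exist _ x (mem_set xU)) * s xU.

Fact sky_scaleA U (f g : regular U) (s : sky U) :
  sky_scale f (sky_scale g s) = sky_scale (f * g) s.
Proof. by apply/funext => xU; rewrite /sky_scale mulrA. Qed.

Fact sky_scale1 U : left_id 1 (@sky_scale U).
Proof. by move=> s; apply/funext => xU; rewrite /sky_scale mul1r. Qed.

Fact sky_scaleDr U : right_distributive (@sky_scale U) +%R.
Proof. by move=> f s t; apply/funext => xU; rewrite /sky_scale mulrDr. Qed.

Fact sky_scaleDl U (s : sky U) : {morph (@sky_scale U)^~ s : f g / f + g}.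
Proof. by move=> f g; apply/funext => xU; rewrite /sky_scale mulrDl. Qed.

HB.instance Definition _ U :=
  GRing.Zmodule_isLmodule.Build (regular U) (sky U)
    (@sky_scaleA U) (@sky_scale1 U) (@sky_scaleDr U) (@sky_scaleDl U).

Definition sky_res U V (VU : V `<=` U) (s : sky U) : sky V :=
  fun xV => s (VU x xV).

Fact sky_resD U V (VU : V `<=` U) (s t : sky U) :
  sky_res VU (s + t) = sky_res VU s + sky_res VU t.
Proof. by []. Qed.

Fact sky_resZ U V (VU : V `<=` U) (f : regular U) (s : sky U) :
  sky_res VU (f *: s) = regular_res VU f *: sky_res VU s.
Proof.
apply/funext => xV; congr (regular_val f _ * _); exact: val_inj.
Qed.

Fact sky_res_id U (UU : U `<=` U) (s : sky U) : sky_res UU s = s.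
Proof. by apply/funext => xU; congr (s _); exact: Prop_irrelevance. Qed.

Fact sky_res_res U V W (VU : V `<=` U) (WV : W `<=` V) (WU : W `<=` U)
  (s : sky U) : sky_res WV (sky_res VU s) = sky_res WU s.
Proof. by apply/funext => xW; congr (s _); exact: Prop_irrelevance. Qed.

Fact sky_sheaf_ext U (I : Type) (V : I -> opens k)
    (VU : forall i, V i `<=` U) (UV : covers U V) (s t : sky U) :
  (forall i, sky_res (VU i) s = sky_res (VU i) t) -> s = t.
Proof.
move=> st; apply/funext => xU.
have [i Vx] := UV (exist _ x (mem_set xU)).
by rewrite (Prop_irrelevance xU (VU i x Vx)); exact: (congr1 (@^~ Vx) (st i)).
Qed.

Fact sky_sheaf_glue U (I : Type) (V : I -> opens k)
    (VU : forall i, V i `<=` U) (UV : covers U V) (s : forall i, sky (V i)) :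
  (forall i j (W : opens k) (Wi : W `<=` V i) (Wj : W `<=` V j),
     sky_res Wi (s i) = sky_res Wj (s j)) ->
  exists t : sky U, forall i, sky_res (VU i) t = s i.
Proof.
move=> sij.
have tP (xU : opens_set U x) : exists a, forall i (Vx : opens_set (V i) x),
    a = s i Vx.
  have [i Vx] := UV (exist _ x (mem_set xU)); exists (s i Vx) => j Vx'.
  have Wi : opensI (V i) (V j) `<=` V i by move=> ? [].
  have Wj : opensI (V i) (V j) `<=` V j by move=> ? [].
  have xW : opens_set (opensI (V i) (V j)) x by split.
  rewrite (Prop_irrelevance Vx (Wi x xW)) (Prop_irrelevance Vx' (Wj x xW)).
  exact: (congr1 (@^~ xW) (sij i j _ Wi Wj)).
have [t tE] := choice tP.
by exists t => i; apply/funext => Vx; exact: tE.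
Qed.

Definition skyscraper : sheaf k := Sheaf sky_resD sky_resZ sky_res_id
  sky_res_res sky_sheaf_ext sky_sheaf_glue.

End Skyscraper.

Section DirectSum.
Variables (k : closedFieldType) (n : nat) (F : 'I_n -> sheaf k).
Implicit Types U V W : opens k.

Definition dsum_sec U : Type := forall i, sec (F i) U.

HB.instance Definition _ U := gen_eqMixin (dsum_sec U).
HB.instance Definition _ U := gen_choiceMixin (dsum_sec U).

Definition dsum_add U (s t : dsum_sec U) : dsum_sec U := fun i => s i + t i.
Definition dsum_opp U (s : dsum_sec U) : dsum_sec U := fun i => - s i.
Definition dsum_zero U : dsum_sec U := fun i => 0.
Definition dsum_scale U (f : regular U) (s : dsum_sec U) : dsum_sec U :=
  fun i => f *: s i.

Fact dsum_addA U : associative (@dsum_add U).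
Proof. by move=> s t u; apply/functional_extensionality_dep => i; exact: addrA. Qed.

Fact dsum_addC U : commutative (@dsum_add U).
Proof. by move=> s t; apply/functional_extensionality_dep => i; exact: addrC. Qed.

Fact dsum_add0 U : left_id (@dsum_zero U) (@dsum_add U).
Proof. by move=> s; apply/functional_extensionality_dep => i; exact: add0r. Qed.

Fact dsum_addN U : left_inverse (@dsum_zero U) (@dsum_opp U) (@dsum_add U).
Proof. by move=> s; apply/functional_extensionality_dep => i; exact: addNr. Qed.

HB.instance Definition _ U := GRing.isZmodule.Build (dsum_sec U)
  (@dsum_addA U) (@dsum_addC U) (@dsum_add0 U) (@dsum_addN U).

Fact dsum_scaleA U (f g : regular U) (s : dsum_sec U) :
  dsum_scale f (dsum_scale g s) = dsum_scale (f * g) s.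
Proof. by apply/functional_extensionality_dep => i; exact: scalerA. Qed.

Fact dsum_scale1 U : left_id 1 (@dsum_scale U).
Proof. by move=> s; apply/functional_extensionality_dep => i; exact: scale1r. Qed.

Fact dsum_scaleDr U : right_distributive (@dsum_scale U) +%R.
Proof. by move=> f s t; apply/functional_extensionality_dep => i; exact: scalerDr. Qed.

Fact dsum_scaleDl U (s : dsum_sec U) :
  {morph (@dsum_scale U)^~ s : f g / f + g}.
Proof. by move=> f g; apply/functional_extensionality_dep => i; exact: scalerDl. Qed.

HB.instance Definition _ U :=
  GRing.Zmodule_isLmodule.Build (regular U) (dsum_sec U)
    (@dsum_scaleA U) (@dsum_scale1 U) (@dsum_scaleDr U) (@dsum_scaleDl U).

Definition dsum_res U V (VU : V `<=` U) (s : dsum_sec U) : dsum_sec V :=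
  fun i => res VU (s i).

Fact dsum_resD U V (VU : V `<=` U) (s t : dsum_sec U) :
  dsum_res VU (s + t) = dsum_res VU s + dsum_res VU t.
Proof. by apply/functional_extensionality_dep => i; exact: resD. Qed.

Fact dsum_resZ U V (VU : V `<=` U) (f : regular U) (s : dsum_sec U) :
  dsum_res VU (f *: s) = regular_res VU f *: dsum_res VU s.
Proof. by apply/functional_extensionality_dep => i; exact: resZ. Qed.

Fact dsum_res_id U (UU : U `<=` U) (s : dsum_sec U) : dsum_res UU s = s.
Proof. by apply/functional_extensionality_dep => i; exact: res_id. Qed.

Fact dsum_res_res U V W (VU : V `<=` U) (WV : W `<=` V) (WU : W `<=` U)
  (s : dsum_sec U) : dsum_res WV (dsum_res VU s) = dsum_res WU s.
Proof. by apply/functional_extensionality_dep => i; exact: res_res. Qed.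

Fact dsum_sheaf_ext U (I : Type) (V : I -> opens k)
    (VU : forall i, V i `<=` U) (UV : covers U V) (s t : dsum_sec U) :
  (forall i, dsum_res (VU i) s = dsum_res (VU i) t) -> s = t.
Proof.
move=> st; apply/functional_extensionality_dep => j.
apply: (@sheaf_ext _ (F j) U I V VU UV) => i.
exact: (congr1 (fun u : dsum_sec (V i) => u j) (st i)).
Qed.

Fact dsum_sheaf_glue U (I : Type) (V : I -> opens k)
    (VU : forall i, V i `<=` U) (UV : covers U V)
    (s : forall i, dsum_sec (V i)) :
  (forall i j (W : opens k) (Wi : W `<=` V i) (Wj : W `<=` V j),
     dsum_res Wi (s i) = dsum_res Wj (s j)) ->
  exists t : dsum_sec U, forall i, dsum_res (VU i) t = s i.
Proof.
move=> sij.
have tP j : {t : sec (F j) U | forall i, res (VU i) t = s i j}.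
  apply: cid; apply: (@sheaf_glue _ (F j) U I V VU UV) => i i' W Wi Wj.
  exact: (congr1 (fun u : dsum_sec W => u j) (sij i i' W Wi Wj)).
exists (fun j => sval (tP j)) => i; apply/functional_extensionality_dep => j.
exact: (svalP (tP j)).
Qed.

Definition dsum : sheaf k := Sheaf dsum_resD dsum_resZ dsum_res_id
  dsum_res_res dsum_sheaf_ext dsum_sheaf_glue.

End DirectSum.

(* E' is the modification of E.  Coherent sheaves form a full subcategory of
   the sheaves of modules, with the same exact sequences: for coherent E' and E
   this is an exact sequence of coherent sheaves. *)
Definition hecke_modification (k : closedFieldType) (x : P1 k) (r : nat)
    (E' E : sheaf k) : Prop :=
  exists (phi : sheaf_hom E' E)
    (psi : sheaf_hom E (dsum (fun _ : 'I_r => skyscraper x))),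
    short_exact phi psi.

(* Functions to {0, 1}, with true = 1 and false = 0. *)
Definition Delta (r n : nat) : {set {ffun 'I_n -> bool}} :=
  [set f : {ffun 'I_n -> bool} | #|[pred i | f i]| == r].

(* Main.v *)
From HB Require Import structures.
Require Import Defs.
From mathcomp Require Import all_boot all_order all_algebra.
From mathcomp Require Import boolp classical_sets functions.
From mathcomp Require Import mpoly perm zify ring.

Set Implicit Arguments.
Unset Strict Implicit.
Unset Printing Implicit Defensive.

Import Order.TTheory GRing.Theory Num.Theory.
Local Open Scope ring_scope.

(* Choose a basis u, w of k^2 with x = [u], and let m, l be the dual linear forms.
   On the chart m != 0, which contains x, put t = l / m; then O(d) is free with
   generator m^d, and its sections are the polynomials in t.

   If (phi, psi) is the exact sequence of a modification, phi becomes a matrix M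
   over k[t].  As psi kills t E, left exactness of sections gives N with N M = t.
   Comparison with the chart l != 0 bounds the degree of the entries:
   deg M_ji <= d_i - d'_j and deg N_ji <= d'_i - d_j + 1.  The image of M(0) is
   the kernel of the surjection of the fibre of E at x onto k^r, so M(0) has rank
   n - r and N(0) rank at most r.  Hence t^r divides det M and t^(n-r) divides
   det N, while their degrees are at most e and n - e, where e is the sum of the
   d_i - d'_i; so e = r.  If d_i < d'_i for some i, then M has a zero block that
   makes det M vanish; so d'_i <= d_i, and likewise d_i - 1 <= d'_i by N.

   Conversely multiply the i-th summand by l^delta(i), and take for psi the values
   at u of the summands with delta(i) = 1. *)

(** * Polynomials and polynomial matrices *)

Section ClosedFieldPoly.
Variable k : closedFieldType.
Implicit Types p q h P : {poly k}.

(** If p were not constant, p + 1 would have a root, and there p takes the value -1. *)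
Lemma closed_poly_eq0 p : (forall t, p.[t] = 0) -> p = 0.
Proof.
move=> p0; apply/eqP; apply: contraT => pn0.
have [sp|sp] := leqP (size p) 1.
  have := p0 0; rewrite (size1_polyC sp) hornerC => c0.
  by move: pn0; rewrite (size1_polyC sp) c0 polyC0 eqxx.
have : size (p + 1) != 1%N by rewrite size_polyDl ?size_polyC ?oner_neq0 // neq_ltn sp orbT.
case/closed_rootP => t /rootP; rewrite hornerD p0 hornerC add0r => /eqP.
by rewrite oner_eq0.
Qed.

Lemma closed_poly_eq h p q : h != 0 ->
  (forall t, h.[t] != 0 -> p.[t] = q.[t]) -> p = q.
Proof.
move=> h0 pq; apply/eqP; rewrite -subr_eq0; apply/eqP.
(* The factor h absorbs the points where p and q are not compared. *)
have: (p - q) * h = 0.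
  apply: closed_poly_eq0 => t; rewrite hornerM hornerD hornerN.
  have [->|/pq->] := eqVneq h.[t] 0; first by rewrite mulr0.
  by rewrite subrr mul0r.
by move/eqP; rewrite mulf_eq0 (negPf h0) orbF => /eqP.
Qed.

(* Regular functions on the affine line are polynomials: all the local fractions
   have the same reduced form P / Q, and Q has no root. *)
Lemma locally_fraction_poly (f : k -> k) :
  (forall t0, exists h F G : {poly k}, h.[t0] != 0 /\
     forall t, h.[t] != 0 -> G.[t] != 0 /\ f t = F.[t] / G.[t]) ->
  exists p, forall t, f t = p.[t].
Proof.
have n0 (q : {poly k}) t : q.[t] != 0 -> q != 0.
  by apply: contraNneq => ->; rewrite horner0.
move=> hf; have [h0 [F0 [G0 [h00 H0]]]] := hf 0.
have G00 : G0 != 0 by have [/n0] := H0 _ h00.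
pose g := gcdp F0 G0.
have g0 : g != 0 by rewrite gcdp_eq0 (negPf G00) andbF.
have FE : F0 = F0 %/ g * g by rewrite divpK // dvdp_gcdl.
have GE : G0 = G0 %/ g * g by rewrite divpK // dvdp_gcdr.
set P := F0 %/ g in FE; set Q := G0 %/ g in GE.
have cPQ : coprimep Q P.
  by rewrite coprimep_sym coprimep_div_gcd // G00 orbT.
have key t0 : Q.[t0] != 0 /\ f t0 * Q.[t0] = P.[t0].
  have [h [F [G [ht0 H]]]] := hf t0.
  (* The local fractions at t0 and at 0 agree wherever neither h nor h0 vanishes, which forces
     equality of the cross products. *)
  have FQ : F * Q = P * G.
    apply: (mulIf g0); rewrite -mulrA -GE mulrAC -FE.
    apply: (@closed_poly_eq (h * h0)); first by rewrite mulf_neq0 ?(n0 _ _ ht0) ?(n0 _ _ h00).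
    move=> t; rewrite hornerM mulf_eq0 negb_or => /andP[/H[Gt fE] /H0[G0t fE0]].
    rewrite !hornerM; have := fE; rewrite fE0 => /eqP.
    by rewrite eqr_div // => /eqP ->; rewrite mulrC.
  (* Being coprime to P, Q divides the local denominator G, so it cannot vanish at t0. *)
  have QG : Q %| G by rewrite -(Gauss_dvdpr _ cPQ) -FQ dvdp_mull.
  have [Gt0 fE] := H _ ht0.
  have Qt0 : Q.[t0] != 0.
    apply: contra Gt0 => /eqP Qt0.
    by case/dvdpP: QG => q ->; rewrite hornerM Qt0 mulr0.
  split=> //; rewrite fE; apply: (mulIf Gt0).
  by rewrite mulrAC divfK // -!hornerM FQ.
have sQ : size Q = 1%N.
  apply/eqP; apply: contraT => /closed_rootP[t /rootP Qt].
  by have [] := key t; rewrite Qt eqxx.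
have QC := size1_polyC (eq_leq sQ).
have Q0 t : Q.[t] = Q`_0 by rewrite QC hornerC coefC.
exists ((Q`_0)^-1 *: P) => t; have [Qt] := key t; rewrite hornerZ => <-.
by rewrite Q0 in Qt *; rewrite mulrC mulfK.
Qed.

(** As t tends to infinity the right side grows at most like t^b, whence deg p + c <= b. The proof
    makes this algebraic by reversing the coefficients of q. *)
Lemma size_poly_reflect p q (b c : nat) :
  (forall t, t != 0 -> t ^+ c * p.[t] = t ^+ b * q.[t^-1]) ->
  p != 0 -> (size p + c <= b + 1)%N.
Proof.
move=> pq p0; pose N := size q.
pose R := \poly_(i < N) q`_(N.-1 - i).
have RE t : t != 0 -> R.[t] = t ^+ N.-1 * q.[t^-1].
  move=> t0; rewrite horner_poly (horner_coef q) mulr_sumr.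
  rewrite (reindex_inj rev_ord_inj) /=; apply: eq_bigr => i _.
  have iN := ltn_ord i; rewrite -/N in iN *.
  have -> : (N - i.+1 = N.-1 - i)%N by lia.
  have -> : (N.-1 - (N.-1 - i) = i)%N by lia.
  rewrite mulrCA; congr (_ * _).
  have {2}-> : N.-1 = (N.-1 - i + i)%N by lia.
  by rewrite exprD exprVn mulfK // expf_neq0.
have E : 'X^(N.-1 + c) * p = 'X^b * R.
  apply: (@closed_poly_eq 'X); rewrite ?polyX_eq0 // => t; rewrite hornerX => t0.
  by rewrite !hornerM !hornerXn RE // exprD -mulrA pq // mulrCA.
have R0 : R != 0.
  apply: contra_neq p0 => R0; move/eqP: E.
  by rewrite R0 mulr0 mulf_eq0 expf_eq0 polyX_eq0 andbF => /eqP.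
have := congr1 (size \o polyseq) E.
rewrite /= [in LHS]mulrC [in RHS]mulrC !size_Mmonic ?monicXn // !size_polyXn /=.
have : (size R <= N)%N by exact: size_poly.
have : (0 < size R)%N by rewrite lt0n size_poly_eq0.
have arith x y z : (0 < x -> x <= z -> (y + (z.-1 + c).+1).-1 = (x + b.+1).-1 ->
  y + c <= b + 1)%N by lia.
exact: arith.
Qed.

End ClosedFieldPoly.

Section DegreeBoundedMatrix.
Variable F : fieldType.

(** The bound e may be negative: the zero polynomial meets every bound, and nothing else meets a
    negative one. *)
Definition deg_le (p : {poly F}) (e : int) : Prop := p != 0 -> (size p)%:Z <= e + 1.

Lemma deg_le_sum (I : finType) (P : pred I) (p : I -> {poly F}) e :
  (forall i, P i -> deg_le (p i) e) -> deg_le (\sum_(i | P i) p i) e.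
Proof.
move=> pe; apply: (big_ind (deg_le^~ e)) => //; first by rewrite /deg_le eqxx.
move=> q q'; rewrite /deg_le => qe qe' qq0.
have := size_polyD q q'.
have [q0|/qe hq] := eqVneq q 0.
  by move: qq0; rewrite q0 add0r => /qe' ?.
have [q0|/qe' hq'] := eqVneq q' 0; first by rewrite q0 addr0.
lia.
Qed.

Lemma deg_le_prod (I : finType) (p : I -> {poly F}) (e : I -> int) :
  (forall i, deg_le (p i) (e i)) -> deg_le (\prod_i p i) (\sum_i e i).
Proof.
move=> pe; apply: (big_ind2 deg_le) => //; first by rewrite /deg_le size_poly1.
move=> q a q' b qe qe' qq0.
have [q0 q'0] : q != 0 /\ q' != 0 by apply/andP; rewrite -negb_or -mulf_eq0.
have := qe q0; have := qe' q'0; rewrite size_mul //.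
have : (0 < size q)%N by rewrite lt0n size_poly_eq0.
have arith (x y : nat) : (0 < x)%N -> y%:Z <= b + 1 -> x%:Z <= a + 1 ->
  (x + y).-1%:Z <= a + b + 1 by lia.
exact: arith.
Qed.

Variables (n : nat) (M : 'M[{poly F}]_n) (a b : 'I_n -> int).
Hypothesis degM : forall j i, deg_le (M j i) (a i - b j).

(** All terms of the Leibniz expansion have the same bound, because permuting the a i leaves their
    sum unchanged. *)
Lemma deg_le_det : deg_le (\det M) (\sum_i a i - \sum_i b i).
Proof.
apply: deg_le_sum => s _ sM0.
have -> : \sum_i a i - \sum_i b i = \sum_j (a (s j) - b j).
  by rewrite sumrB; congr (_ - _); rewrite (reindex_inj (@perm_inj _ s)).
rewrite -signr_odd mulr_sign (fun_if (fun q : {poly F} => size q)) size_polyN if_same.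
apply: deg_le_prod => [j|]; first exact: degM.
by apply: contra_neq sM0 => ->; rewrite mulr0.
Qed.

(* If a i < b i then the entries of M in rows >= i and columns <= i vanish, and
   every permutation meets this block. *)
Lemma det_neq0_deg_le :
  (forall i j : 'I_n, (i <= j)%N -> a i <= a j) ->
  (forall i j : 'I_n, (i <= j)%N -> b i <= b j) ->
  \det M != 0 -> forall i, b i <= a i.
Proof.
move=> sa sb dM i; rewrite leNgt; apply: contra dM => abi.
rewrite /determinant big1 // => s _.
have [j [ij sji]] : exists j : 'I_n, (i <= j)%N /\ (s j <= i)%N.
  have [/existsP[j /andP[]]|] := boolP [exists j : 'I_n, (i <= j)%N && (s j <= i)%N].
    by exists j.
  rewrite negb_exists => /forallP H.
  (* Otherwise s would map the indices >= i injectively into the indices > i, of which there is one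
     fewer. *)
  have sub : s @: [set j : 'I_n | (i <= j)%N] \subset [set j : 'I_n | (i < j)%N].
    apply/fintype.subsetP => l /finset.imsetP[j]; rewrite finset.inE => ij lE.
    by have := H j; rewrite ij /= -ltnNge finset.inE lE.
  have := subset_leq_card sub; rewrite card_imset; last exact: perm_inj.
  have -> : [set j : 'I_n | (i <= j)%N] = i |: [set j : 'I_n | (i < j)%N].
    by apply/finset.setP => j; rewrite !finset.inE leq_eqVlt eq_sym.
  by rewrite cardsU1 finset.inE ltnn add1n ltnn.
rewrite (bigD1 j) //=.
have -> : M j (s j) = 0; last by rewrite mul0r mulr0.
(* The bound a (s j) - b j is at most a i - b i, which is negative. *)
apply/eqP; apply: contraT => Mj; have := degM Mj; move: Mj.
rewrite -size_poly_gt0; have := sa _ _ sji; have := sb _ _ ij; move: abi.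
move: (size _) => sM; lia.
Qed.

End DegreeBoundedMatrix.

(** Invertible constant row operations [L] make all rows beyond the rank of M(0) vanish at 0. Each
    of these rows, at least r in number, contributes a factor X to the determinant. *)
Lemma dvdp_Xn_det (F : fieldType) n (M : 'M[{poly F}]_n) (r : nat) :
  (\rank (map_mx (horner_eval 0) M) + r <= n)%N -> 'X^r %| \det M.
Proof.
set M0 := map_mx _ M => rk.
pose L := invmx (col_ebase M0).
have LM : L *m M0 = pid_mx (\rank M0) *m row_ebase M0.
  by rewrite -[X in L *m X](mulmx_ebase M0) -mulmxA mulKmx ?col_ebase_unit.
pose M1 := map_mx polyC L *m M.
have rowM1 (i : 'I_n) j : (\rank M0 <= i)%N -> 'X %| M1 i j.
  move=> ri; rewrite -['X]subr0 -polyC0 dvdp_XsubCl; apply/rootP.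
  have := congr1 (fun A : 'M_n => A i j) LM.
  rewrite [RHS]mxE big1 => [|l _]; last by rewrite mxE ltnNge ri andbF mul0r.
  move=> E0; rewrite -[RHS]E0 !mxE horner_sum; apply: eq_bigr => l _.
  by rewrite !mxE hornerM hornerC.
have dM1 : 'X^r %| \det M1.
  pose D : 'rV[{poly F}]_n := \row_i (if (\rank M0 <= i)%N then 'X else 1).
  have -> : M1 = diag_mx D *m \matrix_(i, j) (M1 i j %/ D 0 i).
    apply/matrixP => i j; rewrite mul_diag_mx [RHS]mxE [X in _ * X]mxE mulrC divpK // mxE.
    by case: ifP => [ri|_]; [exact: rowM1|exact: dvd1p].
  rewrite det_mulmx det_diag dvdp_mulr //.
  rewrite (eq_bigr (fun i : 'I_n => if (\rank M0 <= i)%N then 'X else 1)) => [|i _]; last first.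
    by rewrite mxE.
  rewrite -big_mkcond /= prodr_const dvdp_exp2l //.
  rewrite cardE size_filter -enumT.
  have -> : count (fun i : 'I_n => (\rank M0 <= i)%N) (enum 'I_n) =
      count (fun i => (\rank M0 <= i)%N) (iota 0 n).
    by rewrite -val_enum_ord count_map.
  rewrite -[X in iota 0 X](@subnKC (\rank M0)) ?rank_leq_row // iotaD count_cat.
  apply: leq_trans (leq_addl _ _).
  rewrite (eq_in_count (a2 := predT)) ?count_predT ?size_iota => [|i]; first by lia.
  by rewrite mem_iota add0n => /andP[].
move: dM1; rewrite det_mulmx det_map_mx /=.
have Lu : \det L != 0 by rewrite -unitfE -unitmxE unitmx_inv col_ebase_unit.
by rewrite mul_polyC dvdpZr.
Qed.

(** * Points, open sets and fractions *)

Lemma meval_dhomogZ (k : comNzRingType) n (F : {mpoly k[n]}) m (a : k) (v : 'rV[k]_n) :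
  F \is m.-homog -> F.@[(a *: v) 0] = a ^+ m * F.@[v 0].
Proof.
move=> /dhomogP Fm; rewrite !mevalE mulr_sumr big_seq [RHS]big_seq.
apply: eq_bigr => M /Fm <-; rewrite mulrCA; congr (_ * _).
rewrite /= mdegE -prodrXr -big_split /=; apply: eq_bigr => i _.
by rewrite mxE exprMn.
Qed.

Lemma meval_line (k : comNzRingType) n (F : {mpoly k[n]}) (u w : 'rV[k]_n) :
  exists p : {poly k}, forall t, F.@[(u + t *: w) 0] = p.[t].
Proof.
exists (mmap polyC (fun i => (u 0 i)%:P + (w 0 i) *: 'X) F) => t.
elim/mpolyind: F => [|c M F _ _ IH]; first by rewrite meval0 mmap0 horner0.
rewrite mevalD mmapD hornerD IH mevalZ mmapZ hornerM hornerC; congr (_ * _ + _).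
rewrite mevalX mmapX /mmap1 horner_prod; apply: eq_bigr => i _.
by rewrite horner_exp hornerD hornerC hornerZ hornerX !mxE mulrC.
Qed.

Section Geometry.
Variable k : closedFieldType.
Implicit Types (p q : P1 k) (U V W : opens k) (v : 'rV[k]_2).

Lemma coords_exists p : exists v, coords p v.
Proof.
exists (vpick (line p)); split; first exact: memv_pick.
by rewrite vpick0 -dimv_eq0 dim_line.
Qed.

Lemma coords_line p v : coords p v -> line p = <[v]>%VS.
Proof.
move=> [pv v0]; apply/eqP; rewrite eq_sym eqEdim -memvE pv dim_line dim_vline.
by rewrite v0.
Qed.

Lemma coords_inj p q v : coords p v -> coords q v -> p = q.
Proof.
move=> /coords_line pv /coords_line qv.
case: p q pv qv => [L dL] [L' dL'] /= EL EL'; move: dL dL'.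
by rewrite EL EL' => dL dL'; congr LineOf; exact: eq_irrelevance.
Qed.

Lemma coords_scale p v w : coords p v -> coords p w -> exists2 a, a != 0 & w = a *: v.
Proof.
move=> pv [pw w0]; move: pw; rewrite (coords_line pv) => /vlineP[a wE].
by exists a => //; apply: contraNneq w0 => a0; rewrite wE a0 scale0r.
Qed.

Lemma point_of v : v != 0 -> exists p, coords p v.
Proof.
move=> v0; have dv : \dim <[v]>%VS = 1%N by rewrite dim_vline v0.
by exists (LineOf dv); split=> //=; exact: memv_line.
Qed.

Lemma cone_of U p v : opens_set U p -> coords p v ->
  exists c : cone U, \val (base c) = p /\ vec c = v.
Proof. by move=> Up pv; exists (@Cone _ U (exist _ p (mem_set Up)) v pv). Qed.

Lemma cone_open U (c : cone U) : opens_set U (\val (base c)).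
Proof. exact: set_mem (valP (base c)). Qed.

Lemma cone_at U (p : U) : exists c : cone U, base c = p.
Proof.
have [v pv] := coords_exists (\val p); by exists (@Cone _ U p v pv).
Qed.

Lemma nonvanishing_open (F : {mpoly k[2]}) : homogeneous F ->
  zariski_open [set p | forall v, coords p v -> F.@[v 0] != 0]%classic.
Proof.
move=> hF; exists [set F]%classic; split=> [_ ->//|p]; split=> [pF|[_ -> //]].
by exists F.
Qed.

Definition nonvanishing (F : {mpoly k[2]}) (hF : homogeneous F) : opens k :=
  Opens (nonvanishing_open hF).

Lemma nonvanishing_cone F (hF : homogeneous F) (c : cone (nonvanishing hF)) : F.@[vec c 0] != 0.
Proof. by have := cone_open c; apply; exact: coords_vec. Qed.

Lemma nonvanishing_coords F (hF : homogeneous F) p v :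
  coords p v -> F.@[v 0] != 0 -> opens_set (nonvanishing hF) p.
Proof.
case: (hF) => m Fm pv Fv w /(coords_scale pv)[a a0 ->].
by rewrite (meval_dhomogZ _ _ Fm) mulf_neq0 ?expf_neq0.
Qed.

Lemma opens_nbhs U p : opens_set U p -> exists F : {mpoly k[2]},
  [/\ homogeneous F, forall v, coords p v -> F.@[v 0] != 0 &
  forall q v, coords q v -> F.@[v 0] != 0 -> opens_set U q].
Proof.
case: U => U [T [hT UT]] /= /UT[F TF Fp]; exists F; split=> //; first exact: hT.
move=> q v qv Fv; apply/UT; exists F => //; exact: (@nonvanishing_coords F (hT _ TF) q v).
Qed.

(** A single fraction valid on the whole cone over U, unlike the local fractions of [is_twisted]. *)
Definition is_fraction U (d : int) (g : 'rV[k]_2 -> k) : Prop :=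
  exists m l (F G : {mpoly k[2]}),
    [/\ F \is m.-homog, G \is l.-homog, m%:Z - l%:Z = d &
    forall c : cone U, G.@[vec c 0] != 0 /\ g (vec c) = F.@[vec c 0] / G.@[vec c 0]].

Lemma is_fraction_homog (F : {mpoly k[2]}) m U : F \is m.-homog ->
  is_fraction U m (fun v => F.@[v 0]).
Proof.
move=> Fm; exists m, 0%N, F, 1; split=> //; [exact: dhomog1|by rewrite subr0|].
by move=> c; rewrite meval1 oner_neq0 divr1.
Qed.

Lemma is_fraction_inv (F : {mpoly k[2]}) m U : F \is m.-homog ->
  (forall c : cone U, F.@[vec c 0] != 0) ->
  is_fraction U (- m%:Z) (fun v => (F.@[v 0])^-1).
Proof.
move=> Fm F0; exists 0%N, m, 1, F; split=> //; [exact: dhomog1|by rewrite sub0r|].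
by move=> c; rewrite meval1 div1r; split.
Qed.

Lemma is_fractionM U d e g h : is_fraction U d g -> is_fraction U e h ->
  is_fraction U (d + e) (fun v => g v * h v).
Proof.
move=> [m [l [F [G [Fm Gl <- FG]]]]] [m' [l' [F' [G' [Fm' Gl' <- FG']]]]].
exists (m + m')%N, (l + l')%N, (F * F'), (G * G').
split; [exact: dhomogM|exact: dhomogM|lia|] => c.
have [G0 ->] := FG c; have [G0' ->] := FG' c.
by rewrite !mevalM mulf_neq0 // mulf_div.
Qed.

Lemma is_fraction_eq U d g h : (forall c : cone U, g (vec c) = h (vec c)) ->
  is_fraction U d g -> is_fraction U d h.
Proof.
move=> gh [m [l [F [G [Fm Gl ml FG]]]]]; exists m, l, F, G; split=> // c.
by rewrite -gh.
Qed.

Lemma is_fraction_expz (F : {mpoly k[2]}) m U (d : int) : F \is m.-homog ->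
  (forall c : cone U, F.@[vec c 0] != 0) ->
  is_fraction U (m%:Z * d) (fun v => F.@[v 0] ^ d).
Proof.
move=> Fm F0; case: d => d.
  apply: is_fraction_eq (is_fraction_homog U (dhomogMn d Fm)) => c.
  by rewrite rmorphXn.
have FX : forall c : cone U, (F ^+ d.+1).@[vec c 0] != 0.
  by move=> c; rewrite rmorphXn /= expf_neq0 ?F0.
have := is_fraction_inv (dhomogMn d.+1 Fm) FX.
rewrite NegzE PoszM mulrN; apply: is_fraction_eq => c.
by rewrite rmorphXn.
Qed.

Lemma twisted_fraction U d g : is_fraction U d g ->
  (fun c : cone U => g (vec c)) \in @twisted_pred k d U.
Proof.
move=> [m [l [F [G [Fm Gl ml FG]]]]]; apply/asboolP => p.
exists U; split; first exact: set_mem (valP p).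
by exists m, l, F, G; split.
Qed.

Definition fraction U d g (h : is_fraction U d g) : twisted d U :=
  Twisted (twisted_fraction h).

(** A fraction of degree 0 takes the same value at all coordinate vectors of a point, so it descends
    to U through any choice [C] of one vector per point. *)
Lemma regular_fraction U g : is_fraction U 0 g ->
  exists f : regular U, forall c : cone U, f (base c) = g (vec c).
Proof.
move=> [m [l [F [G [Fm Gl ml FG]]]]].
have {}ml : l = m by lia.
rewrite {l}ml in Gl.
have gE (c c' : cone U) : base c = base c' -> g (vec c) = g (vec c').
  move=> cc'; have := coords_vec c'; rewrite -cc' => c'v.
  have [a a0 vE] := coords_scale (coords_vec c) c'v.
  have [G0 ->] := FG c; have [G0' ->] := FG c'.
  rewrite vE !(meval_dhomogZ _ _ Fm, meval_dhomogZ _ _ Gl).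
  by rewrite -mulf_div divff ?mul1r // expf_neq0.
have [C hC] := choice (@cone_at U).
have fP : (fun p : U => g (vec (C p))) \in @regular_pred k U.
  apply/asboolP => p; exists U; split; first exact: set_mem (valP p).
  exists m, F, G; split=> // c _; have [G0 <-] := FG c; split=> //.
  by apply: gE; rewrite hC.
by exists (Regular fP) => c /=; apply: gE; rewrite hC.
Qed.

Lemma twisted_homog d U (s : twisted d U) (c c' : cone U) a :
  a != 0 -> vec c' = a *: vec c -> s c' = a ^ d * s c.
Proof.
move=> a0 cc'; case: s => s /= /asboolP/(_ (base c))[V [Vc [m [l [F [G [Fm Gl ml FG]]]]]]].
have bc : \val (base c') = \val (base c).
  have [b b0 bE] : exists2 b, b != 0 & vec c = b *: vec c'.
    by exists a^-1; rewrite ?invr_eq0 // cc' scalerA mulVf ?scale1r.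
  apply: (@coords_inj _ _ (vec c')); first exact: coords_vec.
  have [pv v0] := coords_vec c; split; last by case: (coords_vec c').
  by rewrite cc' memvZ.
have [G0 ->] := FG c Vc; have [|G0' ->] := FG c' _; first by rewrite bc.
rewrite cc' (meval_dhomogZ _ _ Fm) (meval_dhomogZ _ _ Gl) -ml.
by rewrite expfzDr // -exprnN mulf_div.
Qed.

End Geometry.

(** * Sections over a standard chart *)

(* A basis u, w of k^2 together with the dual basis m, l of linear forms. *)
Record frame (k : closedFieldType) := Frame {
  fu : 'rV[k]_2;
  fw : 'rV[k]_2;
  fm : {mpoly k[2]};
  fl : {mpoly k[2]};
  fm_homog : fm \is 1.-homog;
  fl_homog : fl \is 1.-homog;
  frameE : forall v : 'rV[k]_2, v = fm.@[v 0] *: fu + fl.@[v 0] *: fw;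
  fm_comb : forall a b, fm.@[(a *: fu + b *: fw) 0] = a;
  fl_comb : forall a b, fl.@[(a *: fu + b *: fw) 0] = b }.

(** Exchanging the two forms turns every result on the chart m != 0 into one on the chart l != 0,
    which omits only the point [u]. *)
Definition swap (k : closedFieldType) (fr : frame k) : frame k.
Proof.
apply: (@Frame k (fw fr) (fu fr) (fl fr) (fm fr) (fl_homog fr) (fm_homog fr)).
- by move=> v; rewrite addrC; exact: frameE.
- by move=> a b; rewrite addrC fl_comb.
- by move=> a b; rewrite addrC fm_comb.
Defined.

Lemma frame_exists (k : closedFieldType) (x : P1 k) : exists fr : frame k, coords x (fu fr).
Proof.
have [u xu] := coords_exists x.
have ord2 (i : 'I_2) : i = 0 \/ i = 1.
  by case: i => [[|[|//]] ?]; [left|right]; exact: val_inj.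
(* Complete u to a basis of determinant 1; Cramer's rule then gives the dual forms m and l without
   denominators. *)
have [w uw1] : exists w : 'rV[k]_2, u 0 0 * w 0 1 - u 0 1 * w 0 0 = 1.
  have [u0|u0] := eqVneq (u 0 0) 0.
    have u1 : u 0 1 != 0.
      apply: contraNneq xu.2 => u1; apply/eqP/rowP => i; rewrite mxE.
      by have [->|->] := ord2 i.
    exists (\row_i (if i == 0 then - (u 0 1)^-1 else 0)).
    by rewrite !mxE /= mulr0 mulrN sub0r opprK divff.
  exists (\row_i (if i == 0 then 0 else (u 0 0)^-1)).
  by rewrite !mxE /= mulr0 subr0 divff.
pose m : {mpoly k[2]} := w 0 1 *: 'X_0 - w 0 0 *: 'X_1.
pose l : {mpoly k[2]} := u 0 0 *: 'X_1 - u 0 1 *: 'X_0.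
have Xh i : ('X_i : {mpoly k[2]}) \is 1.-homog.
  by rewrite dhomogX; apply/eqP; exact: mdeg1.
have mh : m \is 1.-homog by apply: rpredB; apply: dhomogZ.
have lh : l \is 1.-homog by apply: rpredB; apply: dhomogZ.
have mE (v : 'rV[k]_2) : m.@[v 0] = w 0 1 * v 0 0 - w 0 0 * v 0 1.
  by rewrite mevalB !mevalZ !mevalXU.
have lE (v : 'rV[k]_2) : l.@[v 0] = u 0 0 * v 0 1 - u 0 1 * v 0 0.
  by rewrite mevalB !mevalZ !mevalXU.
have E (v : 'rV[k]_2) : v = m.@[v 0] *: u + l.@[v 0] *: w.
  apply/rowP => i; rewrite !mxE mE lE.
  transitivity ((u 0 0 * w 0 1 - u 0 1 * w 0 0) * v 0 i); first by rewrite uw1 mul1r.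
  by have [->|->] := ord2 i; ring.
have mC a b : m.@[(a *: u + b *: w) 0] = a.
  by rewrite mE !mxE -[RHS]mulr1 -uw1; ring.
have lC a b : l.@[(a *: u + b *: w) 0] = b.
  by rewrite lE !mxE -[RHS]mulr1 -uw1; ring.
by exists (Frame mh lh E mC lC).
Qed.

Section Chart.
Variables (k : closedFieldType) (fr : frame k).
Local Notation u := (fu fr).
Local Notation w := (fw fr).
Local Notation m := (fm fr).
Local Notation l := (fl fr).

Lemma fm_homogeneous : homogeneous m.
Proof. by exists 1%N; exact: fm_homog. Qed.

Definition chart : opens k := nonvanishing fm_homogeneous.

Lemma chart_cone (c : cone chart) : m.@[vec c 0] != 0.
Proof. exact: nonvanishing_cone. Qed.

Lemma fu_neq0 : u != 0.
Proof.
apply/eqP => u0; have := fm_comb fr 1 0.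
have := fm_comb fr 0 0; rewrite u0 !scaler0 => -> /eqP.
by rewrite eq_sym oner_eq0.
Qed.

Lemma fm_u t : m.@[(u + t *: w) 0] = 1.
Proof. by rewrite -{1}[u]scale1r fm_comb. Qed.

Lemma fl_u t : l.@[(u + t *: w) 0] = t.
Proof. by rewrite -{1}[u]scale1r fl_comb. Qed.

Lemma line_neq0 t : u + t *: w != 0.
Proof.
apply/eqP => E; have := fm_u t; rewrite E.
have := fm_comb fr 0 0; rewrite !scale0r addr0 => -> /eqP.
by rewrite eq_sym oner_eq0.
Qed.

Lemma line_chart t : exists c : cone chart, vec c = u + t *: w.
Proof.
have [p pv] := point_of (line_neq0 t).
have Up : opens_set chart p by apply: nonvanishing_coords pv _; rewrite fm_u oner_neq0.
by have [c [_ cv]] := cone_of Up pv; exists c.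
Qed.

(** The form m^(size p) p(l/m). Its degree is one more than deg p if p is nonzero; the surplus
    factor m cancels against the denominator m^(size p). *)
Definition homogenize (p : {poly k}) : {mpoly k[2]} :=
  \sum_(i < size p) p`_i *: (l ^+ i * m ^+ (size p - i)).

Lemma homogenize_homog p : homogenize p \is (size p).-homog.
Proof.
apply: rpred_sum => i _; apply: dhomogZ.
have := dhomogM (dhomogMn i (fl_homog fr)) (dhomogMn (size p - i) (fm_homog fr)).
by rewrite !mul1n subnKC // ltnW.
Qed.

Lemma homogenizeE p (v : 'rV_2) : m.@[v 0] != 0 ->
  (homogenize p).@[v 0] = m.@[v 0] ^+ size p * p.[l.@[v 0] / m.@[v 0]].
Proof.
move=> m0; rewrite raddf_sum horner_coef mulr_sumr; apply: eq_bigr => i _ /=.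
rewrite mevalZ mevalM !rmorphXn /= [RHS]mulrCA; congr (_ * _).
have -> : m.@[v 0] ^+ size p = m.@[v 0] ^+ (size p - i + i) by rewrite subnK // ltnW.
rewrite exprD expr_div_n.
by rewrite mulrACA divff ?expf_neq0 // mulr1 mulrC.
Qed.

Lemma is_fraction_horner p : is_fraction chart 0 (fun v => p.[l.@[v 0] / m.@[v 0]]).
Proof.
exists (size p), (size p), (homogenize p), (m ^+ size p); split.
- exact: homogenize_homog.
- by have := dhomogMn (size p) (fm_homog fr); rewrite mul1n.
- exact: subrr.
move=> c; have m0 := chart_cone c; rewrite rmorphXn /= expf_neq0 //.
by rewrite homogenizeE // mulrAC divff ?mul1r // expf_neq0.
Qed.

Lemma is_fraction_sect d p :
  is_fraction chart d (fun v => m.@[v 0] ^ d * p.[l.@[v 0] / m.@[v 0]]).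
Proof.
have := is_fractionM (is_fraction_expz d (fm_homog fr) chart_cone) (is_fraction_horner p).
by rewrite mul1r addr0.
Qed.

(* Under t = l / m, the chart is the affine line with coordinate ring k[t], and
   O(d) is trivialized by m ^ d. *)
Definition sect d (p : {poly k}) : twisted d chart := fraction (is_fraction_sect d p).

Lemma sectE d p (c : cone chart) :
  sect d p c = m.@[vec c 0] ^ d * p.[l.@[vec c 0] / m.@[vec c 0]].
Proof. by []. Qed.

Definition reg (p : {poly k}) : regular chart :=
  sval (cid (regular_fraction (is_fraction_horner p))).

Lemma regE p (c : cone chart) : reg p (base c) = p.[l.@[vec c 0] / m.@[vec c 0]].
Proof. exact: (svalP (cid (regular_fraction (is_fraction_horner p)))). Qed.

(** On the line u + t w one has m = 1 and l = t, so the section restricts to p(t). *)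
Lemma sect_inj d : injective (sect d).
Proof.
move=> p q pq; apply: (@closed_poly_eq _ 1); rewrite ?oner_neq0 // => t _.
have [c cv] := line_chart t.
have := congr1 (fun s : twisted d chart => s c) pq.
by rewrite !sectE cv fm_u fl_u exp1rz !mul1r divr1.
Qed.

Lemma sectD d p q : sect d (p + q) = sect d p + sect d q.
Proof.
by apply/val_inj/funext => c; rewrite /= hornerD mulrDr.
Qed.

Lemma sect0 d : sect d 0 = 0.
Proof. by apply/val_inj/funext => c; rewrite /= horner0 mulr0. Qed.

Lemma sectM d p q : sect d (p * q) = reg p *: sect d q.
Proof.
by apply/val_inj/funext => c; rewrite /= regE hornerM mulrCA.
Qed.

(** On the line u + t w, s is locally a fraction in t, hence a polynomial p(t). Every vector of the
    cone is m times a vector u + (l / m) w, so homogeneity recovers s from p. *)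
Lemma sect_surj d (s : twisted d chart) : exists p, s = sect d p.
Proof.
have [C hC] := choice line_chart.
have [|p pE] := @locally_fraction_poly _ (fun t => s (C t)).
  move=> t0; case: (s) => s' /= /asboolP/(_ (base (C t0)))[V [Vt [a [b [F [G [Fa Gb ab FG]]]]]]].
  have [H [hH H0 HV]] := opens_nbhs Vt.
  have [hh hE] := meval_line H u w.
  have [ff fE] := meval_line F u w.
  have [gg gE] := meval_line G u w.
  exists hh, ff, gg; rewrite -hE -hC; split; first exact: H0 (coords_vec _).
  move=> t; rewrite -hE -fE -gE -hC => Ht.
  by apply: FG; apply: HV Ht; exact: coords_vec.
exists p; apply/val_inj/funext => c /=; have m0 := chart_cone c.
rewrite -pE; apply: twisted_homog => //.
by rewrite hC scalerDr scalerA mulrCA divff // mulr1 -frameE.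
Qed.

End Chart.

(** * Left exactness and sections of direct sums *)

(** Local preimages of t are unique because phi is injective on every open set, so they agree on
    overlaps and glue. *)
Lemma short_exact_left (k : closedFieldType) (F G H : sheaf k)
    (phi : sheaf_hom F G) (psi : sheaf_hom G H) (U : opens k) (t : sec G U) :
  short_exact phi psi -> psi U t = 0 -> exists s, phi U s = t.
Proof.
move=> [inj ker _] /ker loc.
have loc' (p : U) : exists z : {V : opens k & {VU : (V `<=` U)%classic & sec F V}},
    opens_set (projT1 z) (\val p) /\
    phi _ (projT2 (projT2 z)) = res (projT1 (projT2 z)) t.
  by have [V [VU [Vp [s sE]]]] := loc p; exists (existT _ V (existT _ VU s)).
have [z zP] := choice loc'.
pose V p := projT1 (z p).
pose VU p : (V p `<=` U)%classic := projT1 (projT2 (z p)).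
pose s p : sec F (V p) := projT2 (projT2 (z p)).
have UV : covers U V by move=> p; exists p; exact: (zP p).1.
have sE p : phi _ (s p) = res (VU p) t := (zP p).2.
have [s0 s0E] : exists s0 : sec F U, forall p, res (VU p) s0 = s p.
  apply: sheaf_glue => // p q W Wp Wq; apply: inj.
  by rewrite !hom_res !sE !(res_res _ _ (subset_trans Wp (VU p))).
exists s0; apply: (sheaf_ext (VU := VU) UV) => p.
by rewrite -hom_res s0E sE.
Qed.

Section DirectSumSections.
Variables (k : closedFieldType) (fr : frame k).
Local Notation u := (fu fr).
Local Notation w := (fw fr).
Local Notation m := (fm fr).
Local Notation l := (fl fr).

Definition dsect n (d : 'I_n -> int) (P : 'rV[{poly k}]_n) :
  sec (dsum (fun i => twist k (d i))) (chart fr) := fun i => sect fr (d i) (P 0 i).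

Lemma dsect_inj n (d : 'I_n -> int) : injective (dsect d).
Proof.
move=> P Q PQ; apply/rowP => i; apply: (@sect_inj _ fr (d i)).
exact: (congr1 (fun s : dsum_sec _ _ => s i) PQ).
Qed.

Lemma dsect_surj n (d : 'I_n -> int) s : exists P, s = dsect d P.
Proof.
have [p pE] := choice (fun i => sect_surj (s i)).
exists (\row_i p i); apply/functional_extensionality_dep => i.
by rewrite /dsect mxE -pE.
Qed.

Lemma dsectZ n (d : 'I_n -> int) p P : dsect d (p *: P) = reg fr p *: dsect d P.
Proof.
apply/functional_extensionality_dep => i.
by rewrite /dsect mxE sectM.
Qed.

Lemma dsectD n (d : 'I_n -> int) P Q : dsect d (P + Q) = dsect d P + dsect d Q.
Proof.
apply/functional_extensionality_dep => i.
by rewrite /dsect mxE sectD.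
Qed.

Lemma dsect0 n (d : 'I_n -> int) : dsect d 0 = 0.
Proof.
apply/functional_extensionality_dep => i.
by rewrite /dsect mxE sect0.
Qed.

Lemma dsect_lin n (d : 'I_n -> int) I (r : seq I) (p : I -> {poly k}) P :
  dsect d (\sum_(i <- r) p i *: P i) = \sum_(i <- r) reg fr (p i) *: dsect d (P i).
Proof.
elim: r => [|i r IH]; first by rewrite !big_nil dsect0.
by rewrite !big_cons dsectD dsectZ IH.
Qed.

Lemma linear_dsect n n' (d : 'I_n -> int) (d' : 'I_n' -> int)
    (f : {linear sec (dsum (fun i => twist k (d' i))) (chart fr) ->
                 sec (dsum (fun i => twist k (d i))) (chart fr)}) :
  exists M, forall P, f (dsect d' P) = dsect d (P *m M).
Proof.
have [R RE] := choice (fun j => dsect_surj (f (dsect d' (delta_mx 0 j)))).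
exists (\matrix_j R j) => P; rewrite {1}[P]row_sum_delta dsect_lin linear_sum.
rewrite mulmx_sum_row dsect_lin; apply: eq_bigr => j _.
by rewrite linearZ rowK RE.
Qed.

Lemma is_fraction_coord_pow (e : int) :
  is_fraction (opensI (chart fr) (chart (swap fr))) 0
    (fun v => (l.@[v 0] / m.@[v 0]) ^ e).
Proof.
set UW := opensI _ _.
have m0 (c : cone UW) : m.@[vec c 0] != 0.
  by have [+ _] := cone_open c; apply; exact: coords_vec.
have l0 (c : cone UW) : l.@[vec c 0] != 0.
  by have [_] := cone_open c; apply; exact: coords_vec.
have := is_fractionM (is_fraction_expz e (fl_homog fr) l0)
  (is_fraction_expz (- e) (fm_homog fr) m0).
rewrite mulrN subrr; apply: is_fraction_eq => c.
by rewrite expfzMl -exprz_inv exprz_inv.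
Qed.

End DirectSumSections.

(** * Matrices of a modification *)

Section Overlap.
Variables (k : closedFieldType) (fr : frame k).
Local Notation u := (fu fr).
Local Notation w := (fw fr).
Local Notation m := (fm fr).
Local Notation l := (fl fr).

Definition overlap : opens k := opensI (chart fr) (chart (swap fr)).

Lemma overlap_l : (overlap `<=` chart fr)%classic.
Proof. by move=> p []. Qed.

Lemma overlap_r : (overlap `<=` chart (swap fr))%classic.
Proof. by move=> p []. Qed.

(** The unit t^e of the overlap, which relates the trivializations over the two charts. *)
Definition coord_pow (e : int) : regular overlap :=
  sval (cid (regular_fraction (is_fraction_coord_pow fr e))).

Lemma coord_powE e (c : cone overlap) :
  coord_pow e (base c) = (l.@[vec c 0] / m.@[vec c 0]) ^ e.
Proof. exact: (svalP (cid (regular_fraction (is_fraction_coord_pow fr e)))). Qed.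

(** Evaluation at u + t w turns the relation into t^(d_i) Q_i(1/t) = t^e P_i(t), where Q_i(1/t) has
    no pole at infinity. *)
Lemma overlap_deg n (d : 'I_n -> int) (P Q : 'rV[{poly k}]_n) e :
  res overlap_r (dsect (swap fr) d Q) = coord_pow e *: res overlap_l (dsect fr d P) ->
  forall i, deg_le (P 0 i) (d i - e).
Proof.
move=> PQ i Pi0.
have H t : t != 0 -> t ^ d i * (Q 0 i).[t^-1] = t ^ e * (P 0 i).[t].
  move=> t0; have [p pv] := point_of (line_neq0 fr t).
  have Up : opens_set overlap p.
    split; first by apply: nonvanishing_coords pv _; rewrite fm_u oner_neq0.
    by apply: nonvanishing_coords pv _; rewrite fl_u.
  have [c [_ cv]] := cone_of Up pv.
  have := congr1 (fun s : dsum_sec (fun i => twist k (d i)) overlap => twisted_val (s i) c) PQ.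
  rewrite /= coord_powE cv fm_u fl_u.
  by rewrite div1r exp1rz mul1r divr1.
(* The exponent d_i - e may be negative; writing it as b - c leaves only natural powers of t on both
   sides. *)
have [b [c bc]] : exists b c : nat, d i - e = b%:Z - c%:Z.
  case: (d i - e) => a; first by exists a, 0%N; rewrite subr0.
  by exists 0%N, a.+1; rewrite sub0r NegzE.
have := @size_poly_reflect _ (P 0 i) (Q 0 i) b c _ Pi0.
have arith (z : nat) : (z + c <= b + 1)%N -> z%:Z <= b%:Z - c%:Z + 1 by lia.
rewrite bc => h; apply/arith/h => t t0.
have te : t ^ e != 0 by rewrite expfz_neq0.
apply: (mulfI te); rewrite mulrCA -H // !mulrA !exprnP -!expfzDr //.
by congr (_ ^ _ * _); lia.
Qed.

(** The generator over the chart l != 0 is l^(d_j), and l = t m. *)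
Lemma overlap_dsect n (d : 'I_n -> int) j (e : nat) :
  res overlap_r (dsect (swap fr) d (delta_mx 0 j)) =
  coord_pow (d j - e%:Z) *: res overlap_l (dsect fr d ('X^e *: delta_mx 0 j)).
Proof.
apply/functional_extensionality_dep => i; apply/val_inj/funext => c.
rewrite /= coord_powE !mxE eqxx /=.
have m0 : m.@[vec c 0] != 0 by have [+ _] := cone_open c; apply; exact: coords_vec.
have l0 : l.@[vec c 0] != 0 by have [_] := cone_open c; apply; exact: coords_vec.
have [->|_] := eqVneq i j; last by rewrite mulr0 !horner0 !mulr0.
rewrite mulr1 hornerXn hornerC mulr1 mulrCA exprnP -expfzDr ?mulf_neq0 ?invr_eq0 //.
by rewrite subrK expfzMl mulrCA -expfzMl divff // exp1rz mulr1.
Qed.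

End Overlap.

Section HeckeMatrices.
Variables (k : closedFieldType) (fr : frame k) (n : nat) (d d' : 'I_n -> int).
Local Notation E' := (dsum (fun i => twist k (d' i))).
Local Notation E := (dsum (fun i => twist k (d i))).
Variable phi : sheaf_hom E' E.
Local Notation U := (chart fr).
Local Notation W := (chart (swap fr)).

Lemma hom_matrix : exists2 M : 'M[{poly k}]_n,
  (forall P, phi U (dsect fr d' P) = dsect fr d (P *m M)) &
  forall j i, deg_le (M j i) (d i - d' j).
Proof.
have [M ME] := linear_dsect (phi U).
have [M' ME'] := linear_dsect (phi W).
exists M => // j i.
(* The j-th rows are the images of the j-th generators of E' over the two charts, which differ by
   t^(d'_j) on the overlap. *)
have := @overlap_deg _ fr n d (row j M) (row j M') (d' j) _ i; rewrite mxE; apply.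
rewrite !rowE -ME -ME' -!hom_res -linearZ; congr (phi _ _).
by have := overlap_dsect fr d' j 0; rewrite expr0 scale1r subr0.
Qed.

Lemma hecke_matrices (x : P1 k) (r : nat)
    (psi : sheaf_hom E (dsum (fun _ : 'I_r => skyscraper x))) :
  coords x (fu fr) -> short_exact phi psi ->
  exists M N : 'M[{poly k}]_n,
  [/\ forall P, phi U (dsect fr d' P) = dsect fr d (P *m M),
   N *m M = 'X%:M,
   forall j i, deg_le (M j i) (d i - d' j) &
   forall j i, deg_le (N j i) (d' i - (d j - 1))].
Proof.
move=> xu ex; have [M ME degM] := hom_matrix.
(* As t vanishes at x, psi kills t times the j-th generator; the coordinates of a preimage under phi
   become row j of N. *)
have nP j : exists P, phi U (dsect fr d' P) = dsect fr d ('X *: delta_mx 0 j).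
  have [|s sE] := @short_exact_left _ _ _ _ _ _ U (dsect fr d ('X *: delta_mx 0 j)) ex.
    rewrite dsectZ linearZ; apply/functional_extensionality_dep => i.
    apply/funext => xU; rewrite /= -[LHS]/(_ * _).
    have [c [cx cv]] := cone_of xU xu.
    have -> : exist _ x (mem_set xU) = base c by exact/val_inj.
    rewrite regE cv -[fu fr]addr0 -(scale0r (fw fr)) fl_u fm_u hornerX.
    by rewrite mul0r mul0r.
  by have [P PE] := dsect_surj s; exists P; rewrite -PE.
(* The chart l != 0 omits x, so the skyscraper has only the zero section there and the generator
   itself lifts. *)
have n'P j : exists P, phi W (dsect (swap fr) d' P) = dsect (swap fr) d (delta_mx 0 j).
  have [|s sE] := @short_exact_left _ _ _ _ _ _ W (dsect (swap fr) d (delta_mx 0 j)) ex.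
    apply/functional_extensionality_dep => i.
    apply/funext => xW; have := xW _ xu.
    by rewrite /= -[fu fr]addr0 -(scale0r (fw fr)) fl_u eqxx.
  by have [P PE] := dsect_surj s; exists P; rewrite -PE.
have [N NE] := choice nP; have [N' NE'] := choice n'P.
exists M, (\matrix_j N j); split=> //.
  apply/row_matrixP => j; rewrite row_mul rowK; apply: (@dsect_inj _ fr _ d).
  by rewrite -ME NE -scalemx1 linearZ /= row1.
move=> j i; rewrite mxE.
(* Injectivity of phi carries the relation between l^(d_j) and t m^(d_j), a factor t^(d_j - 1), over
   to their preimages. *)
have := @overlap_deg _ fr n d' (N j) (N' j) (d j - 1) _ i; apply.
case: ex => inj _ _; apply: inj.
rewrite linearZ !hom_res NE NE'.
by have := overlap_dsect fr d j 1; rewrite expr1.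
Qed.

End HeckeMatrices.

(** * The fibre at x *)

Section Fiber.
Variables (k : closedFieldType) (x : P1 k) (r : nat).
Implicit Types U V : opens k.
Local Notation K := (dsum (fun _ : 'I_r => skyscraper x)).

Definition fiber U (xU : opens_set U x) (s : sec K U) : 'rV[k]_r :=
  \row_j (s j : sky x U) xU.

Lemma fiber_res U V (VU : (V `<=` U)%classic) xU xV (s : sec K U) :
  fiber xV (res VU s) = fiber xU s.
Proof.
by apply/rowP => j; rewrite !mxE /= /sky_res; congr (s j _); exact: Prop_irrelevance.
Qed.

Lemma fiberZ U xU (f : regular U) (s : sec K U) (c : cone U) :
  \val (base c) = x -> fiber xU (f *: s) = f (base c) *: fiber xU s.
Proof.
move=> cx; apply/rowP => j; rewrite !mxE.
by congr (regular_val f _ * _); exact: val_inj.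
Qed.

Lemma fiber_sum U xU I (rI : seq I) (s : I -> sec K U) :
  fiber xU (\sum_(i <- rI) s i) = \sum_(i <- rI) fiber xU (s i).
Proof.
elim: rI => [|i rI IH]; first by rewrite !big_nil; apply/rowP => j; rewrite !mxE.
by rewrite !big_cons -IH; apply/rowP => j; rewrite !mxE.
Qed.

Lemma fiber_inj U xU : injective (@fiber U xU).
Proof.
move=> s t st; apply/functional_extensionality_dep => j; apply/funext => xU'.
rewrite (Prop_irrelevance xU' xU).
by have := congr1 (fun v : 'rV_r => v 0 j) st; rewrite !mxE.
Qed.

Lemma fiber0 U xU : @fiber U xU 0 = 0.
Proof. by apply/rowP => j; rewrite !mxE. Qed.

Variables (fr : frame k) (xu : coords x (fu fr)).
Local Notation w := (fw fr).

Lemma chart_x : opens_set (chart fr) x.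
Proof.
by apply: nonvanishing_coords xu _; rewrite -[fu fr]addr0 -(scale0r w) fm_u oner_neq0.
Qed.

Lemma fiber_reg p (s : sec K (chart fr)) :
  fiber chart_x (reg fr p *: s) = p.[0] *: fiber chart_x s.
Proof.
have [c [cx cv]] := cone_of chart_x xu.
rewrite (fiberZ _ _ _ cx) regE cv.
by rewrite -[fu fr]addr0 -(scale0r w) fl_u fm_u mul0r.
Qed.

Variables (n : nat) (d : 'I_n -> int).
Local Notation E := (dsum (fun i => twist k (d i))).
Variable psi : sheaf_hom E K.

(** The matrix of the map k^n -> k^r that psi induces on the fibre of E at x, in the basis of the
    generators m^(d_i). *)
Definition fiber_mx : 'M[k]_(n, r) :=
  \matrix_i fiber chart_x (psi (chart fr) (dsect fr d (delta_mx 0 i))).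

Local Notation at0 := (map_mx (horner_eval 0)).

(** Functions act on the skyscraper through their value at x, which is the point t = 0. *)
Lemma fiber_psi (P : 'rV_n) :
  fiber chart_x (psi (chart fr) (dsect fr d P)) = at0 P *m fiber_mx.
Proof.
rewrite {1}[P]row_sum_delta dsect_lin linear_sum fiber_sum mulmx_sum_row.
apply: eq_bigr => i _.
by rewrite linearZ fiber_reg rowK mxE.
Qed.

(** Projection to the i-th summand, kept inside E; it reduces the next lemma to sections with a
    single local denominator. *)
Definition mask V (i : 'I_n) (t : sec E V) : sec E V :=
  fun i' => if i' == i then t i' else 0.

Lemma sum_mask V (t : sec E V) : t = \sum_i mask i t.
Proof.
apply/functional_extensionality_dep => i.
have -> : (\sum_i0 mask i0 t) i = \sum_i0 (mask i0 t i).
  by apply: (big_morph (fun s : sec E V => s i)).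
rewrite (bigD1 i) //= big1 ?addr0 => [|j ji]; first by rewrite /mask eqxx.
by rewrite /mask eq_sym (negPf ji).
Qed.

(* Near x a section of O(d_i) is F / G, and G / m^b is a regular function with
   nonzero value at x; multiplying by it gives a section F / m^b that extends to
   the whole chart, so no division by l is needed. *)
Lemma fiber_psi_sub V (VU : (V `<=` chart fr)%classic) xV (t : sec E V) :
  (fiber xV (psi V t) <= fiber_mx)%MS.
Proof.
rewrite (sum_mask t) linear_sum fiber_sum summx_sub // => i _.
have [c0 [c0x c0v]] := cone_of xV xu.
have [/= V1 [V1x [a [b [F [G [Fa Gb ab FG]]]]]]] :=
  asboolP _ (twistedP (t i : twisted (d i) V)) (base c0).
rewrite c0x in V1x.
pose V' := opensI V V1.
have V'V : (V' `<=` V)%classic by move=> ? [].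
have V'U := subset_trans V'V VU.
have xV' : opens_set V' x by [].
have m0 (c : cone V') : (fm fr).@[vec c 0] != 0.
  by have /V'U := cone_open c; apply; exact: coords_vec.
have m0U := @chart_cone _ fr.
have [h hE] : exists h : regular V', forall c, h (base c) =
    G.@[vec c 0] * (fm fr).@[vec c 0] ^ (- b%:Z).
  apply: (@regular_fraction _ V' (fun v => G.@[v 0] * (fm fr).@[v 0] ^ (- b%:Z))).
  have := is_fractionM (is_fraction_homog V' Gb) (is_fraction_expz (- b%:Z) (fm_homog fr) m0).
  by rewrite mul1r subrr.
have fS : is_fraction (chart fr) (d i) (fun v => F.@[v 0] * (fm fr).@[v 0] ^ (- b%:Z)).
  have := is_fractionM (is_fraction_homog (chart fr) Fa)
    (is_fraction_expz (- b%:Z) (fm_homog fr) m0U).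
  by rewrite mul1r ab.
have [p pE] := sect_surj (fraction fS).
have key : h *: res V'V (mask i t) = res V'U (dsect fr d (p *: delta_mx 0 i)).
  apply/functional_extensionality_dep => i'; apply/val_inj/funext => c.
  rewrite /= /mask !mxE eqxx /=; case: eqVneq => [->|_]; last by rewrite !mulr0 horner0 mulr0.
  have := congr1 (fun s : twisted (d i) (chart fr) => s (cone_incl V'U c)) pE.
  rewrite /= mulr1 => <-; rewrite hE.
  have [_ V1c] := cone_open c.
  have [G0 ->] := FG (cone_incl V'V c) V1c.
  by rewrite /= mulrC mulrA divfK.
have [c [cx cv]] := cone_of xV' xu.
have hc0 : h (base c) != 0.
  rewrite hE mulf_neq0 ?expfz_neq0 //.
  by have [] := FG (cone_incl V'V c) (cone_open c).2.
(* On the fibre, h acts by the nonzero scalar h(x), while the right side of [key] extends to the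
   chart, where [fiber_psi] applies. *)
have := congr1 (fun s => fiber xV' (psi V' s)) key.
rewrite linearZ (fiberZ _ _ _ cx) !hom_res (fiber_res _ xV) (fiber_res _ chart_x).
rewrite fiber_psi => E1.
rewrite -[fiber _ _](scalerK hc0) E1 scalemx_sub // submxMl //.
Qed.

Section Exact.
Variables (d' : 'I_n -> int) (phi : sheaf_hom (dsum (fun i => twist k (d' i))) E).
Hypothesis ex : short_exact phi psi.

(** Each basis vector of k^r comes from a section that lifts to E near x, and by [fiber_psi_sub] the
    images of local sections lie in the row space. *)
Lemma fiber_mx_full : row_full fiber_mx.
Proof.
case: ex => _ _ surj; rewrite -sub1mx; apply/row_subP => j.
pose s : sec K (chart fr) := fun j' _ => (j == j')%:R.
have [V [VU [Vx [t tE]]]] := surj (chart fr) s (exist _ x (mem_set chart_x)).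
have := fiber_psi_sub VU Vx t; rewrite tE (fiber_res _ chart_x).
suff -> : fiber chart_x s = row j 1%:M by [].
by apply/rowP => j'; rewrite !mxE.
Qed.

Lemma rank_hom_matrix (M : 'M[{poly k}]_n) :
  (forall P, phi (chart fr) (dsect fr d' P) = dsect fr d (P *m M)) ->
  (\rank (at0 M) + r = n)%N.
Proof.
move=> ME.
have MA : at0 M *m fiber_mx = 0.
  apply/row_matrixP => j; rewrite row_mul row0 -map_row -fiber_psi rowE -ME.
  case: ex => _ ker _.
  have -> : psi (chart fr) (phi (chart fr) (dsect fr d' (delta_mx 0 j))) = 0.
    apply/ker => p; exists (chart fr), (@subset_refl _ _); split.
      exact: set_mem (valP p).
    by exists (dsect fr d' (delta_mx 0 j)); rewrite res_id.
  exact: fiber0.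
have rA : \rank fiber_mx = r by exact/eqP/fiber_mx_full.
(* A kernel vector, taken as a constant section, is killed by psi; left exactness gives P with P M
   equal to it, and t = 0 puts it in the row space of M(0). *)
have kM : (kermx fiber_mx <= at0 M)%MS.
  apply/row_subP => i; set v := row i _.
  have vA : v *m fiber_mx = 0 by apply/sub_kermxP; exact: row_sub.
  have vE : at0 (map_mx polyC v) = v by apply/rowP => j; rewrite !mxE /horner_eval hornerC.
  have [|s sE] := @short_exact_left _ _ _ _ _ _ (chart fr) (dsect fr d (map_mx polyC v)) ex.
    by apply: (@fiber_inj _ chart_x); rewrite fiber_psi vE vA fiber0.
  have [P PE] := dsect_surj s.
  move: sE; rewrite PE ME => /dsect_inj/(congr1 at0).
  by rewrite vE map_mxM => <-; rewrite submxMl.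
have := mxrankS kM; have := mulmx0_rank_max MA; rewrite mxrank_ker rA.
have := rank_leq_row fiber_mx; rewrite rA; lia.
Qed.

End Exact.
End Fiber.

(** * Degrees of a modification *)

Lemma hecke_degrees (F : fieldType) n (d d' : 'I_n -> int) r (M N : 'M[{poly F}]_n) :
  (forall i j : 'I_n, (i <= j)%N -> d i <= d j) ->
  (forall i j : 'I_n, (i <= j)%N -> d' i <= d' j) ->
  N *m M = 'X%:M -> (\rank (map_mx (horner_eval 0) M) + r = n)%N ->
  (forall j i, deg_le (M j i) (d i - d' j)) ->
  (forall j i, deg_le (N j i) (d' i - (d j - 1))) ->
  (forall i, d i - 1 <= d' i <= d i) /\ \sum_i (d i - d' i) = r%:Z.
Proof.
move=> sd sd' NM rM degM degN.
have detNM : \det N * \det M = 'X^n by rewrite -det_mulmx NM det_scalar.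
have [N0 M0] : \det N != 0 /\ \det M != 0.
  by apply/andP; rewrite -negb_or -mulf_eq0 detNM expf_eq0 polyX_eq0 andbF.
have sd1 : forall i j : 'I_n, (i <= j)%N -> d i - 1 <= d j - 1.
  by move=> i j ij; rewrite lerB // sd.
split.
  move=> i; rewrite (det_neq0_deg_le degM sd sd' M0).
  by rewrite (det_neq0_deg_le degN sd' sd1 N0).
(* N(0) M(0) = 0 bounds the rank of N(0) by n minus that of M(0), that is by r. *)
have NM0 : map_mx (horner_eval 0) N *m map_mx (horner_eval 0) M = 0.
  rewrite -map_mxM NM map_scalar_mx /= /horner_eval hornerX.
  exact: raddf0.
have rN : (\rank (map_mx (horner_eval 0) N) + (n - r) <= n)%N.
  by have := mulmx0_rank_max NM0; lia.
have size_dvd e (p : {poly F}) : p != 0 -> 'X^e %| p -> (e < size p)%N.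
  by move=> p0 /(dvdp_leq p0); rewrite size_polyXn.
(* With e the sum of the d_i - d'_i, the four bounds give r <= e and n - r <= n - e. *)
have := size_dvd _ _ M0 (dvdp_Xn_det (eq_leq rM)).
have := size_dvd _ _ N0 (dvdp_Xn_det rN).
have := deg_le_det degM M0; have := deg_le_det degN N0.
rewrite !sumrB sumr_const card_ord.
move: (size _) (size _) (\sum_i d i) (\sum_i d' i) => a b D D'.
rewrite -mulr_natl natz mulr1; lia.
Qed.

Lemma hecke_modification_degrees (k : closedFieldType) (x : P1 k) n
  (d d' : 'I_n -> int) r :
  (forall i j : 'I_n, (i <= j)%N -> d i <= d j) ->
  (forall i j : 'I_n, (i <= j)%N -> d' i <= d' j) ->
  hecke_modification x r
    (dsum (fun i => twist k (d' i))) (dsum (fun i => twist k (d i))) ->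
  exists delta : {ffun 'I_n -> bool}, delta \in Delta r n /\
    forall i : 'I_n, d' i = d i - (delta i : nat)%:Z.
Proof.
move=> sd sd' [phi [psi ex]]; have [fr xu] := frame_exists x.
have [M [N [ME NM degM degN]]] := hecke_matrices xu ex.
have rM := rank_hom_matrix xu ex ME.
have [dd' sumd] := hecke_degrees sd sd' NM rM degM degN.
exists [ffun i => d' i != d i].
have dE i : d' i = d i - (d' i != d i : nat)%:Z.
  by have := dd' i; case: eqVneq => /= [->|]; lia.
split; last by move=> i; rewrite ffunE -dE.
rewrite finset.inE -eqz_nat -sumd -sum1_card big_mkcond /=.
apply/eqP; rewrite -[LHS]natz natr_sum; apply: eq_bigr => i _.
rewrite [i \in _]ffunE {2}dE opprB addrCA subrr addr0.
by case: (_ != _).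
Qed.

(** * Sections vanishing at a point *)

Section VanishingAtPoint.
Variables (k : closedFieldType) (fr : frame k).
Local Notation u := (fu fr).
Local Notation w := (fw fr).
Local Notation m := (fm fr).
Local Notation l := (fl fr).
Implicit Types U V : opens k.

(** At a zero c of l, restrict a local numerator to the line c + t w. It vanishes at all t != 0 of a
    nonempty open set, hence identically, and t = 0 gives the value at c. *)
Lemma twisted_eq0 d U (s : twisted d U) :
  (forall c : cone U, l.@[vec c 0] != 0 -> s c = 0) -> s = 0.
Proof.
move=> s0; apply/val_inj/funext => c /=.
have [lc|/s0//] := eqVneq l.@[vec c 0] 0.
have [V [Vc [a [b [F [G [Fa Gb ab FG]]]]]]] := asboolP _ (twistedP s) (base c).
have [_ ->] := FG c Vc.
have [H [hH H0 HUV]] := @opens_nbhs _ (opensI U V) _ (conj (cone_open c) Vc).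
have [hh hE] := meval_line H (vec c) w.
have [ff fE] := meval_line F (vec c) w.
have lw t : l.@[(vec c + t *: w) 0] = t.
  by rewrite [vec c](frameE fr) lc scale0r addr0 fl_comb.
suff ff0 : ff = 0.
  by rewrite -[vec c]addr0 -(scale0r w) fE ff0 horner0 mul0r.
apply: (@closed_poly_eq _ ('X * hh)).
  rewrite mulf_neq0 ?polyX_eq0 //.
  apply: contraTneq (H0 _ (coords_vec c)) => hh0.
  by rewrite -[vec c]addr0 -(scale0r w) hE hh0 horner0 eqxx.
move=> t; rewrite hornerM hornerX mulf_eq0 negb_or -hE => /andP[t0 Ht].
have v0 : vec c + t *: w != 0.
  apply: contra_neq t0 => E; rewrite -(lw t) E.
  by have := fl_comb fr 0 0; rewrite !scale0r addr0.
have [p pv] := point_of v0; have [Up Vp] := HUV _ _ pv Ht.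
have [c' [c'p c'v]] := cone_of Up pv.
have [|G0] := FG c' _; first by rewrite c'p.
rewrite (s0 c') c'v ?lw // => /esym/eqP.
rewrite mulf_eq0 invr_eq0 -c'v (negPf G0) orbF c'v fE => /eqP ->.
by rewrite horner0.
Qed.

Lemma coords_fl0 p (v : 'rV[k]_2) : coords p v -> l.@[v 0] = 0 -> coords p u.
Proof.
move=> [pv v0] lv; split; last exact: fu_neq0.
have vE : v = m.@[v 0] *: u by rewrite {1}[v](frameE fr) lv scale0r addr0.
have m0 : m.@[v 0] != 0 by apply: contraNneq v0 => m0; rewrite vE m0 scale0r.
by rewrite -[u](scalerK m0) -vE memvZ.
Qed.

(** The numerator F vanishes at u. On the chart it is m^a p(t) with p(0) = 0, so p = t q and F = l
    m^(a-1) q(t). *)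
Lemma divide_at_point d U (s : twisted d U) x : coords x u -> opens_set U x ->
  (forall c : cone U, l.@[vec c 0] = 0 -> s c = 0) ->
  exists V, opens_set V x /\ exists e f (F G : {mpoly k[2]}),
    [/\ F \is e.-homog, G \is f.-homog, e%:Z - f%:Z = d - 1 &
    forall c : cone U, opens_set V (\val (base c)) ->
      G.@[vec c 0] != 0 /\ s c = l.@[vec c 0] * (F.@[vec c 0] / G.@[vec c 0])].
Proof.
move=> xu xU s0; have [c0 [c0x c0v]] := cone_of xU xu.
have [V [Vx [a [b [F [G [Fa Gb ab FG]]]]]]] := asboolP _ (twistedP s) (base c0).
have lu : l.@[u 0] = 0 by rewrite -[u]addr0 -(scale0r w) fl_u.
have mu : m.@[u 0] = 1 by rewrite -[u]addr0 -(scale0r w) fm_u.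
have Fu : F.@[u 0] = 0.
  have [G0] := FG c0 Vx; rewrite s0 ?c0v // => /esym/eqP.
  by rewrite mulf_eq0 invr_eq0 -c0v (negPf G0) orbF => /eqP.
have [p pE] := sect_surj (fraction (is_fraction_homog (chart fr) Fa)).
have Fp (c : cone (chart fr)) : F.@[vec c 0] = m.@[vec c 0] ^ a * p.[l.@[vec c 0] / m.@[vec c 0]].
  exact: (congr1 (fun s : twisted a (chart fr) => s c) pE).
have [q qE] : exists q, p = q * 'X.
  apply/dvdpP; rewrite -['X]subr0 -polyC0 dvdp_XsubCl; apply/rootP.
  have [c [_ cv]] := cone_of (chart_x xu) xu.
  by have := Fp c; rewrite cv Fu lu mu mul0r exp1rz mul1r.
(* The quotient m^(a-1) q(l/m) is again a fraction, with a - 1 taken in the integers since a may be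
   0. *)
have [a' [b' [F' [G' [Fa' Gb' ab' FG']]]]] := is_fraction_sect fr (a%:Z - 1) q.
rewrite c0x in Vx.
exists (opensI V (chart fr)); split; first by split=> //; exact: chart_x.
exists a', (b + b')%N, F', (G * G'); split=> //; [exact: dhomogM|lia|].
move=> c [Vc /cone_sub[c' [c'b c'v]]].
have [G0 ->] := FG c Vc; have [G0' E'] := FG' c'; have m0 := chart_cone c'.
rewrite -c'v in G0 *; rewrite !mevalM mulf_neq0 //; split=> //.
rewrite invfM (mulrC G.@[_]^-1) [F'.@[_] * _]mulrA -E' Fp qE hornerM hornerX.
rewrite expfzDr // exprN1; field.
by apply/andP.
Qed.

Lemma twisted_divide d U (s : twisted d U) :
  (forall c : cone U, l.@[vec c 0] = 0 -> s c = 0) ->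
  exists s' : twisted (d - 1) U, forall c, s c = l.@[vec c 0] * s' c.
Proof.
move=> s0.
(* The function g supplies s / l at the zeros of l, which all lie over one point x; if x is not in U
   there are none and g is arbitrary. *)
have [g gP] : exists g : 'rV[k]_2 -> k, forall c0 : cone U, l.@[vec c0 0] = 0 ->
  exists V, opens_set V (\val (base c0)) /\ exists e f (F G : {mpoly k[2]}),
    [/\ F \is e.-homog, G \is f.-homog, e%:Z - f%:Z = d - 1 &
    forall c : cone U, opens_set V (\val (base c)) ->
      [/\ G.@[vec c 0] != 0, l.@[vec c 0] = 0 -> g (vec c) = F.@[vec c 0] / G.@[vec c 0]
       & s c = l.@[vec c 0] * (F.@[vec c 0] / G.@[vec c 0])]].
  have [x xu] := point_of (fu_neq0 fr).
  have [xU|xU] := pselect (opens_set U x); last first.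
    exists (fun=> 0) => c0 /(coords_fl0 (coords_vec c0))/coords_inj/(_ xu) cx.
    by case: xU; rewrite -cx; exact: cone_open.
  have [V [Vx [a [b [F [G [Fa Gb ab FG]]]]]]] := divide_at_point xu xU s0.
  exists (fun v => F.@[v 0] / G.@[v 0]) => c0.
  move=> /(coords_fl0 (coords_vec c0))/coords_inj/(_ xu) ->.
  exists V; split=> //; exists a, b, F, G; split=> // c /FG[G0 sE]; split=> //.
pose s' (c : cone U) := if l.@[vec c 0] == 0 then g (vec c) else s c / l.@[vec c 0].
have sE c : s c = l.@[vec c 0] * s' c.
  by rewrite /s'; case: eqVneq => [l0|l0]; [rewrite s0 // l0 mul0r|rewrite mulrC divfK].
suff s'P : s' \in @twisted_pred k (d - 1) U by exists (Twisted s'P).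
apply/asboolP => p; have [c0 c0p] := cone_at p.
have [l0|l0] := eqVneq l.@[vec c0 0] 0.
  have [V [Vp [a [b [F [G [Fa Gb ab FG]]]]]]] := gP c0 l0.
  rewrite c0p in Vp; exists V; split=> //; exists a, b, F, G; split=> // c Vc.
  have [G0 gE sc] := FG c Vc; split=> //; rewrite /s'.
  by case: eqVneq => [|lc]; [exact: gE|rewrite sc mulrC mulKf].
have [V [Vp [a [b [F [G [Fa Gb ab FG]]]]]]] := asboolP _ (twistedP s) p.
(* Where l does not vanish, it is absorbed into the denominator. *)
exists (opensI V (chart (swap fr))); split.
  by split=> //; rewrite -c0p; apply: nonvanishing_coords (coords_vec c0) l0.
exists a, (b + 1)%N, F, (G * l); split=> //.
- exact: dhomogM Gb (fl_homog fr).
- lia.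
move=> c [Vc lc]; have {}lc : l.@[vec c 0] != 0 by apply: lc (coords_vec c).
have [G0 sc] := FG c Vc; rewrite mevalM mulf_neq0 //; split=> //.
by rewrite /s' (negPf lc) sc invfM mulrA.
Qed.

End VanishingAtPoint.

(** * The elementary modification *)

Lemma twisted_mul_homog (k : closedFieldType) (U : opens k) (F : {mpoly k[2]}) m d e
    (s : twisted d U) : F \is m.-homog -> d + m%:Z = e ->
  (fun c => F.@[vec c 0] * s c) \in @twisted_pred k e U.
Proof.
move=> Fm de; apply/asboolP => p.
have [V [Vp [a [b [A [B [Aa Bb ab AB]]]]]]] := asboolP _ (twistedP s) p.
exists V; split=> //; exists (m + a)%N, b, (F * A), B; split=> //.
- exact: dhomogM.
- lia.
by move=> c /AB[B0 ->]; rewrite mevalM mulrA.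
Qed.

Section ElementaryModification.
Variables (k : closedFieldType) (x : P1 k) (n r : nat) (d d' : 'I_n -> int).
Variables (delta : {ffun 'I_n -> bool}) (fr : frame k).
Hypothesis xu : coords x (fu fr).
Hypothesis d'E : forall i, d' i = d i - (delta i : nat)%:Z.
Variable sigma : 'I_r -> 'I_n.
Hypothesis sigma_inj : injective sigma.
Hypothesis deltaE : forall i, delta i <-> exists j, i = sigma j.
Local Notation u := (fu fr).
Local Notation w := (fw fr).
Local Notation m := (fm fr).
Local Notation l := (fl fr).
Local Notation E' := (dsum (fun i => twist k (d' i))).
Local Notation E := (dsum (fun i => twist k (d i))).
Local Notation K := (dsum (fun _ : 'I_r => skyscraper x)).
Implicit Types U V : opens k.

Lemma l_delta_homog i : l ^+ delta i \is (delta i).-homog.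
Proof. by have := dhomogMn (delta i) (fl_homog fr); rewrite mul1n. Qed.

Lemma d'_delta i : d' i + (delta i : nat)%:Z = d i.
Proof. by rewrite d'E subrK. Qed.

Definition mul_delta U (s : sec E' U) : sec E U :=
  fun i => Twisted (twisted_mul_homog (s i) (l_delta_homog i) (d'_delta i)).

Lemma mul_delta_linear U : linear (@mul_delta U).
Proof.
move=> f s t; apply/functional_extensionality_dep => i; apply/val_inj/funext => c /=.
by rewrite mulrDr mulrCA.
Qed.

HB.instance Definition _ U :=
  GRing.isLinear.Build (regular U) (sec E' U) (sec E U) _ (@mul_delta U) (@mul_delta_linear U).

Lemma mul_delta_res U V (VU : (V `<=` U)%classic) (s : sec E' U) :
  mul_delta (res VU s) = res VU (mul_delta s).
Proof.
by apply/functional_extensionality_dep => i; apply/val_inj/funext => c.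
Qed.

Definition mul_delta_hom : sheaf_hom E' E :=
  @SheafHom _ E' E (fun U => @mul_delta U : {linear _ -> _}) mul_delta_res.

Definition cone_x U (xU : opens_set U x) : cone U :=
  @Cone _ U (exist _ x (mem_set xU)) u xu.

(** Evaluation at the fixed vector u trivializes the fibre of every O(d) at x; [sigma] lists the
    summands with delta(i) = 1. *)
Definition eval_x U (s : sec E U) : sec K U :=
  fun j xU => twisted_val (s (sigma j)) (cone_x xU).

Lemma eval_x_linear U : linear (@eval_x U).
Proof.
by move=> f s t; apply/functional_extensionality_dep => j; apply/funext => xU.
Qed.

HB.instance Definition _ U :=
  GRing.isLinear.Build (regular U) (sec E U) (sec K U) _ (@eval_x U) (@eval_x_linear U).

Lemma eval_x_res U V (VU : (V `<=` U)%classic) (s : sec E U) :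
  eval_x (res VU s) = res VU (eval_x s).
Proof.
apply/functional_extensionality_dep => j; apply/funext => xV /=.
by rewrite /eval_x /=; congr (twisted_val _ _); exact: cone_eq.
Qed.

Definition eval_x_hom : sheaf_hom E K :=
  @SheafHom _ E K (fun U => @eval_x U : {linear _ -> _}) eval_x_res.

Lemma mul_deltaE U (s : sec E' U) i (c : cone U) :
  twisted_val (mul_delta s i) c = l.@[vec c 0] ^+ delta i * twisted_val (s i) c.
Proof. by rewrite /= rmorphXn. Qed.

Lemma fl_x : l.@[u 0] = 0.
Proof. by rewrite -[u]addr0 -(scale0r w) fl_u. Qed.

(** Where l is nonzero its powers cancel, and [twisted_eq0] extends the equality across x. *)
Lemma mul_delta_inj U : injective (@mul_delta U).
Proof.
move=> s t st; apply/functional_extensionality_dep => i.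
apply/eqP; rewrite -subr_eq0; apply/eqP.
apply: (@twisted_eq0 _ fr (d' i) U) => c lc.
have := congr1 (fun s : dsum_sec (fun i => twist k (d i)) U => twisted_val (s i) c) st.
rewrite !mul_deltaE => /(mulfI (expf_neq0 _ lc)) E1.
by rewrite -[LHS]/(twisted_val (s i) c - twisted_val (t i) c) E1 subrr.
Qed.

(** A component with delta(i) = 1 vanishes at u, hence by homogeneity at all coordinate vectors of
    x, and is divisible by l; the other components are their own preimages. *)
Lemma eval_x_eq0 U (t : sec E U) : eval_x t = 0 -> exists s, mul_delta s = t.
Proof.
move=> t0.
have tx i : delta i -> forall c : cone U, l.@[vec c 0] = 0 -> twisted_val (t i) c = 0.
  move=> /deltaE[j ->] c lc.
  have bx : \val (base c) = x.
    exact: coords_inj (coords_fl0 (coords_vec c) lc) xu.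
  have xU : opens_set U x by rewrite -bx; exact: cone_open.
  have E0 : twisted_val (t (sigma j)) (cone_x xU) = 0.
    exact: (congr1 (fun s : dsum_sec (fun _ : 'I_r => skyscraper x) U => s j xU) t0).
  have xc : coords x (vec c) by rewrite -bx; exact: coords_vec.
  have [a a0 cE] := coords_scale xu xc.
  by rewrite (@twisted_homog _ _ _ _ (cone_x xU) c a a0 cE) E0 mulr0.
have sP i : exists s : twisted (d' i) U, forall c,
    twisted_val (t i) c = l.@[vec c 0] ^+ delta i * s c.
  rewrite d'E; have := tx i; case: (delta i) => [/(_ isT) t0'|_].
    by have [s sE] := twisted_divide t0'; exists s => c; rewrite expr1.
  by rewrite subr0; exists (t i) => c; rewrite expr0 mul1r.
have [s sE] : exists s : sec E' U, forall i c,
    twisted_val (t i) c = l.@[vec c 0] ^+ delta i * twisted_val (s i) c.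
  by exists (fun i => sval (cid (sP i))) => i c; case: (cid (sP i)).
exists s; apply/functional_extensionality_dep => i; apply/val_inj/funext => c.
by rewrite [LHS]mul_deltaE -sE.
Qed.

Lemma elementary_modification_exact : short_exact mul_delta_hom eval_x_hom.
Proof.
split.
- exact: mul_delta_inj.
- move=> U t; split=> [/eval_x_eq0[s <-] p|loc].
    exists U, (@subset_refl _ _); split; first exact: set_mem (valP p).
    by exists s; rewrite res_id.
  (* The component [sigma j] of a local image contains the factor l, which vanishes at u. *)
  apply/functional_extensionality_dep => j; apply/funext => xU.
  have [V [VU [xV [s sE]]]] := loc (exist _ x (mem_set xU)).
  have := congr1 (fun s : dsum_sec (fun i => twist k (d i)) V =>
    twisted_val (s (sigma j)) (cone_x xV)) sE.
  rewrite [LHS]mul_deltaE /= fl_x.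
  have -> : delta (sigma j) by apply/deltaE; exists j.
  rewrite expr1 mul0r => E0.
  rewrite -[LHS]/(twisted_val (t (sigma j)) (cone_x xU)) -[RHS]/0 [RHS]E0.
  by congr (twisted_val _ _); exact: cone_eq.
move=> U v p.
have [px|px] := pselect (\val p = x); last first.
  (* Away from x, shrink to the chart l != 0: the skyscraper is zero there and 0 is a lift. *)
  have sub : (opensI U (chart (swap fr)) `<=` U)%classic by move=> ? [].
  exists (opensI U (chart (swap fr))), sub; split.
    split; first exact: set_mem (valP p).
    move=> z pz; apply/negP => /eqP lz; apply: px.
    exact: coords_inj (coords_fl0 pz lz) xu.
  exists 0; apply/functional_extensionality_dep => j; apply/funext => xV.
  by have [_ /(_ _ xu)] := xV; rewrite fl_x eqxx.
have xU : opens_set U x by rewrite -px; exact: set_mem (valP p).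
pose V := opensI U (chart fr).
have VU : (V `<=` U)%classic by move=> ? [].
have Vc : (V `<=` chart fr)%classic by move=> ? [].
exists V, VU; split; first by rewrite px; split=> //; exact: chart_x.
(* The constant a i is the prescribed value v_j if i = sigma j, and 0 off the image of sigma. Since
   m(u) = 1, the section with constant coordinate a i takes that value at u. *)
pose a i : k := \sum_j (sigma j == i)%:R * (v j : sky x U) xU.
exists (res Vc (dsect fr d (\row_i (a i)%:P))).
apply/functional_extensionality_dep => j; apply/funext => xV.
rewrite -[LHS]/(m.@[u 0] ^ d (sigma j) * ((\row_i (a i)%:P) 0 (sigma j)).[l.@[u 0] / m.@[u 0]]).
rewrite mxE hornerC -{1}[u]addr0 -(scale0r w) fm_u exp1rz mul1r /a.
rewrite (bigD1 j) //= eqxx mul1r big1 ?addr0 => [|j' j'j].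
  by rewrite /sky_res; congr (v j _); exact: Prop_irrelevance.
by rewrite (inj_eq sigma_inj) (negPf j'j) mul0r.
Qed.

End ElementaryModification.

Lemma degrees_hecke_modification (k : closedFieldType) (x : P1 k) n
  (d d' : 'I_n -> int) r (delta : {ffun 'I_n -> bool}) :
  delta \in Delta r n -> (forall i, d' i = d i - (delta i : nat)%:Z) ->
  hecke_modification x r
    (dsum (fun i => twist k (d' i))) (dsum (fun i => twist k (d i))).
Proof.
rewrite finset.inE => /eqP rE d'E; have [fr xu] := frame_exists x.
pose sigma (j : 'I_r) : 'I_n := enum_val (cast_ord (esym rE) j).
have sigma_inj : injective sigma by move=> i j /enum_val_inj/cast_ord_inj.
have deltaE i : delta i <-> exists j, i = sigma j.
  split=> [di|[j ->]]; last exact: (enum_valP (cast_ord (esym rE) j)).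
  exists (cast_ord rE (enum_rank_in (di : i \in [pred i | delta i]) i)).
  by rewrite /sigma cast_ordK enum_rankK_in.
exists (mul_delta_hom fr d'E), (eval_x_hom d xu sigma).
exact: elementary_modification_exact.
Qed.

Theorem theorem3p11 (k : closedFieldType) (x : P1 k) (n : nat)
  (d d' : 'I_n -> int)
  (d_sorted : forall i j : 'I_n, (i <= j)%N -> d i <= d j)
  (d'_sorted : forall i j : 'I_n, (i <= j)%N -> d' i <= d' j)
  (r : nat) (r_le_n : (r <= n)%N) :
  hecke_modification x r
    (dsum (fun i => twist k (d' i))) (dsum (fun i => twist k (d i))) <->
  exists delta : {ffun 'I_n -> bool}, delta \in Delta r n /\
    forall i : 'I_n, d' i = d i - (delta i : nat)%:Z.
Proof.
split; first exact: hecke_modification_degrees.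
by move=> [delta [deltaP d'E]]; exact: degrees_hecke_modification deltaP d'E.
Qed.
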